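(* Let $\Gamma_M$ be a perfect matching graph of a connected trivalent ribbon graph $\Gamma$ with a perfect matching $M$. Let $n\in \mathbb{N}$ and let $\mathbb{k}$ be a ring in which $\sqrt{n}$ is defined. Then the bigraded $n$-color homology $CH_n^{*,*}(\Gamma_M;\mathbb{k})$ is an invariant of $\Gamma_M$, i.e., it depends only on the ribbon graph $\Gamma$ and the perfect matching $M$. Furthermore, its graded Euler characteristic is the $n$-color polynomial: $$\langle \Gamma_M \rangle_n = \chi_q(CH^{*,*}_n(\Gamma_M;\mathbb{k})).$$
   Context: Graphs are finite multigraphs. A ribbon graph $\Gamma$ of a connected graph $G$ is a compact surface with boundary containing $G$ (as a 1-dimensional CW complex) that deformation retracts onto $G$; equivalently one disk per vertex and one band per edge. $\overline\Gamma$ is the closed surface obtained by gluing a disk to each boundary component; ribbon graphs are considered up to equivalence, where two ribbon graphs are equivalent if there is a homeomorphism of the closed surfaces inducing an isomorphism of the underlying graphs. A perfect matching graph $\Gamma_M$ is a ribbon graph $\Gamma$ of a trivalent graph $G$ together with a perfect matching $M=\{e_1,\dots,e_\ell\}$ (every vertex is incident to exactly one edge of $M$). States: for $e\in M$ with ends $u,v$, each of the two sides of the band of $e$ runs at $u$ next to exactly one of the two other half-edges at $u$, and at $v$ next to exactly one of the two other half-edges at $v$; so the sides of $e$ pair the remaining half-edges at $u$ with those at $v$. The 0-smoothing at $e$ deletes $e,u,v$ and joins half-edges by this pairing; the 1-smoothing joins them by the other pairing. For $\alpha\in\{0,1\}^\ell$ the state $\Gamma_\alpha$ is the set of circles obtained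 by performing the $\alpha_i$-smoothing at every $e_i$; $k_\alpha$ is its number of circles, $|\alpha|=\sum\alpha_i$. Put $m=\lfloor n/2\rfloor$. The $n$-color polynomial is $\langle\Gamma_M\rangle_n(q)=\sum_{\alpha}(-q^m)^{|\alpha|}\big(\sum_{k=0}^{n-1}q^{m-k}\big)^{k_\alpha}$. Bigraded $n$-color homology: let $V=\mathbb{k}[x]/(x^n)$, graded by $\deg x^k=m-k$ $(0\le k\le n-1)$. Let $V_\alpha=V^{\otimes k_\alpha}\{m|\alpha|\}$ (one tensor factor per circle; $\{s\}$ raises degrees by $s$), and $C^{i,*}(\Gamma_M)=\bigoplus_{|\alpha|=i}V_\alpha$, where the second grading $j$ is the (shifted) degree. If $\alpha'$ is obtained from $\alpha$ by changing one $0$ (in position $p$) to $1$, then passing from $\Gamma_\alpha$ to $\Gamma_{\alpha'}$ either fuses two circles into one, splits one circle into two, or changes one circle to one circle; $\partial_{\alpha\alpha'}:V_\alpha\to V_{\alpha'}$ is the identity on the factors of the unaffected circles and, on the affected ones, respectively: multiplication $a\otimes b\mapsto ab$ in $V$; $\Delta(x^k)=\sum_{i+j=k+2m,\,0\le i,j\le n-1}x^i\otimes x^j$; $\eta(x^k)=\sqrt n\,x^{k+m}$. The differential $\partial:C^{i,j}\to C^{i+1,j}$ is $\partial|_{V_\alpha}=\sum_{\alpha'}(-1)^{\alpha_1+\dots+\alpha_{p-1}}\partial_{\alpha\alpha'}$. Then $CH_n^{i,j}(\Gamma_M;\mathbb{k})$ is the homology of $(C^{*,*}(\Gamma_M),\partial)$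 at $(i,j)$. ''A ring in which $\sqrt n$ is defined'' means a ring containing a square root of $n$ (for example $\mathbb{R}$ or $\mathbb{C}$, or $\mathbb{Z}$ when $n$ is a perfect square). The graded Euler characteristic is the alternating sum of graded dimensions, $\chi_q(H)=\sum_{i}(-1)^i\, q\!\dim H^{i,*}$ with $q\!\dim H^{i,*}=\sum_j q^j\dim H^{i,j}$. *)

(* Defs.v *)
From HB Require Import structures.
From mathcomp Require Import all_boot all_order all_fingroup all_algebra.
From mathcomp Require Import generic_quotient ring_quotient fraction.
From mathcomp Require Import boolp fsbigop.
From mathcomp Require classical_sets.

Set Implicit Arguments.
Unset Strict Implicit.
Unset Printing Implicit Defensive.

Import GRing.Theory.
Import Quotient.Exports.
Local Open Scope ring_scope.
Local Open Scope quotient_scope.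

(* A possibly non-orientable surface made of one disk per vertex and one band
   per edge.  Darts are the half-edges; each vertex disk carries a chosen
   orientation, and [rotation h] is the half-edge that follows [h]
   counterclockwise around its vertex.  [twist h] tells whether the band of the edge of [h] is
   twisted with respect to the orientations chosen at its two ends.  Changing
   the choices of orientation is part of [equivalent] below. *)
Record ribbon_graph := RibbonGraph {
  dart : finType;
  rotation : {perm dart};
  opposite : dart -> dart;
  twist : dart -> bool;
  oppositeK : involutive opposite;
  opposite_neq : forall h, opposite h != h;
  twist_opposite : forall h, twist (opposite h) = twist h }.

Section Graph.
Variable G : ribbon_graph.

Definition vertices : {set {set dart G}} := porbits (rotation G).

Definition edge (h : dart G) : {set dart G} := [set h; opposite h].

Definition edges : {set {set dart G}} := [set edge h | h : dart G].

Definition connected_graph : Prop :=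
  (0 < #|dart G|)%N /\
  forall x y : dart G,
    connect (fun a b : dart G => (b == rotation G a) || (b == opposite a)) x y.

Definition trivalent : Prop := forall v, v \in vertices -> #|v| = 3.

(* Counting half-edges excludes loops from a perfect matching. *)
Definition perfect_matching (M : {set {set dart G}}) : Prop :=
  M \subset edges /\
  forall v, v \in vertices -> #|[set h in v | edge h \in M]| = 1%N.

Definition enumerates (e : seq {set dart G}) (M : {set {set dart G}}) : Prop :=
  uniq e /\ e =i M.

End Graph.

(* [phi] is the induced isomorphism of graphs and [eps], which is constant on
   vertices, records the vertex disks on which the homeomorphism reverses the
   chosen orientations. *)
Definition equivalent (G G' : ribbon_graph)
    (M : {set {set dart G}}) (M' : {set {set dart G'}}) : Prop :=
  exists (phi : dart G -> dart G') (eps : dart G -> bool),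
    [/\ bijective phi,
        forall h, eps (rotation G h) = eps h,
        forall h, phi (rotation G h)
                  = if eps h then (rotation G')^-1%g (phi h)
                    else rotation G' (phi h),
        forall h, phi (opposite h) = opposite (phi h) /\
                  twist (phi h) = twist h (+) eps h (+) eps (opposite h) &
        [set phi @: x | x : {set dart G} in M] = M'].

Section States.
Variables (G : ribbon_graph) (e : seq {set dart G}).

Definition state := {ffun 'I_(size e) -> bool}.

Definition medge (p : 'I_(size e)) : {set dart G} := tnth (in_tuple e) p.

Definition weight (a : state) : nat := \sum_(p < size e) a p.

Definition side (b : bool) (h : dart G) : dart G :=
  if b then rotation G h else (rotation G)^-1%g h.

(* Along an untwisted band, the side that runs next to [side b h] at one end
   runs next to [side (~~ b) (opposite h)] at the other end; along a twisted
   band, next to [side b (opposite h)].  The 0-smoothing joins the half-edges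
   paired in this way, the 1-smoothing uses the other pairing. *)
Definition joined (a : state) (x y : dart G) : bool :=
  [exists p : 'I_(size e), [exists h in medge p, [exists b : bool,
     (x == side b h) && (y == side (~~ b (+) twist h (+) a p) (opposite h))]]].

Definition linked (a : state) (x y : dart G) : bool :=
  (y == opposite x) || joined a x y.

(* A circle is encoded by the set of half-edges it is made of. *)
Definition circles (a : state) : {set {set dart G}} :=
  [set [set y | connect (linked a) x y] | x : dart G & edge x \notin e].

Definition circle (a : state) := {c : {set dart G} | c \in circles a}.

Definition touches (p : 'I_(size e)) (c : {set dart G}) : bool :=
  [exists h in medge p, [exists b : bool, side b h \in c]].

Definition affected (p : 'I_(size e)) (a : state) : seq (circle a) :=
  [seq c <- enum {: circle a} | touches p (val c)].

Definition flip_at (p : 'I_(size e)) (a a' : state) : bool :=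
  ~~ a p && (a' == [ffun q => (q == p) || a q]).

End States.

Definition qvar : {fraction {poly int}} := tofrac 'X.

Definition color_polynomial (n : nat) (G : ribbon_graph)
    (e : seq {set dart G}) : {fraction {poly int}} :=
  let m := n./2 in
  \sum_(a : state e)
    (- qvar ^+ m) ^+ weight a
    * (\sum_(k < n) qvar ^ (m%:Z - k%:Z)) ^+ #|circles a|.

Section QuotientModule.
Variables (k : pzRingType) (V : lmodType k).
Variables (I : {pred V}) (hI : submod_closed I).

Definition submodule_pred & submod_closed I : {pred V} := I.
Local Notation J := (submodule_pred hI).
HB.instance Definition _ :=
  GRing.isZmodClosed.Build V J (GRing.submod_closedB hI).

Definition mquot := Quotient.quot J.
HB.instance Definition _ := GRing.Zmodule.on mquot.

Definition proj (v : V) : mquot := \pi_(Quotient.quot J) v.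

Lemma proj_eq (v w : V) : (proj v == proj w) = (v - w \in I).
Proof. by rewrite -[RHS]/(v - w \in J) Quotient.idealrBE. Qed.

Lemma projD : {morph proj : v w / v + w}.
Proof. by move=> v w; exact: (@Quotient.pi_add V J). Qed.

Definition mquot_scale (c : k) (x : mquot) : mquot :=
  proj (c *: repr (x : Quotient.quot J)).

Lemma mquot_scale_proj c v : mquot_scale c (proj v) = proj (c *: v).
Proof.
apply/eqP; rewrite proj_eq -scalerBr.
apply: (GRing.submod_closed_semi hI).2.
by rewrite -proj_eq; apply/eqP; exact: reprK.
Qed.

Lemma proj_surj (x : mquot) : {v | x = proj v}.
Proof. by exists (repr (x : Quotient.quot J)); rewrite /proj reprK. Qed.

Lemma mquot_scaleA a b (x : mquot) :
  mquot_scale a (mquot_scale b x) = mquot_scale (a * b) x.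
Proof. by case: (proj_surj x) => v ->; rewrite !mquot_scale_proj scalerA. Qed.

Lemma mquot_scale1 : left_id 1 mquot_scale.
Proof.
by move=> x; case: (proj_surj x) => v ->; rewrite mquot_scale_proj scale1r.
Qed.

Lemma mquot_scaleDr : right_distributive mquot_scale +%R.
Proof.
move=> a x y; case: (proj_surj x) => v ->; case: (proj_surj y) => w ->.
by rewrite -projD !mquot_scale_proj scalerDr projD.
Qed.

Lemma mquot_scaleDl (x : mquot) : {morph mquot_scale^~ x : a b / a + b}.
Proof.
move=> a b; case: (proj_surj x) => v ->.
by rewrite !mquot_scale_proj scalerDl projD.
Qed.

HB.instance Definition _ := GRing.Zmodule_isLmodule.Build k mquot
  mquot_scaleA mquot_scale1 mquot_scaleDr mquot_scaleDl.

End QuotientModule.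

Definition isomorphic (k : pzRingType) (H H' : lmodType k) : Prop :=
  exists f : {linear H -> H'}, bijective f.

(* [H] becomes free of rank [r] over the total ring of fractions of [k].  Over
   a field this says that [H] has dimension [r], and over an integral domain
   that [H] tensored with the field of fractions has dimension [r]. *)
Definition has_rank (k : comNzRingType) (H : lmodType k) (r : nat) : Prop :=
  exists x : 'I_r -> H,
    (forall a : 'I_r -> k, \sum_i a i *: x i = 0 -> forall i, a i = 0) /\
    (forall y : H, exists2 c : k, GRing.lreg c &
       exists a : 'I_r -> k, c *: y = \sum_i a i *: x i).

Definition integral_domain (k : comNzRingType) : Prop :=
  forall a b : k, a * b = 0 -> a = 0 \/ b = 0.

Section Complex.
Variables (k : comNzRingType) (n : nat) (sqrtn : k).
Variables (G : ribbon_graph) (e : seq {set dart G}).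

Let m : nat := n./2.

(* Matrix coefficients, in the basis [x^i], of the multiplication of
   [k[x]/(x^n)], of Delta and of eta. *)
Definition mul_coef (i j l : 'I_n) : k := ((l : nat) == i + j)%N%:R.
Definition comul_coef (l i j : 'I_n) : k := (i + j == l + m.*2)%N%:R.
Definition eta_coef (i l : 'I_n) : k := sqrtn * ((l : nat) == i + m)%N%:R.

(* A basis element of the sum of all the [V_a] is a state [a] together with the
   pure tensor that has [x^(f c)] as its factor at the circle [c]. *)
Definition generator := {a : state e & {ffun circle a -> 'I_n}}.

Definition gen_state (b : generator) : state e := tag b.
Definition gen_label (b : generator) : {ffun circle (gen_state b) -> 'I_n} :=
  tagged b.

Definition hdeg (b : generator) : nat := weight (gen_state b).

Definition qdeg (b : generator) : int :=
  \sum_(c : circle (gen_state b)) (m%:Z - (gen_label b c : nat)%:Z)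
  + (m * weight (gen_state b))%N%:Z.

Definition chains := {ffun generator -> k^o}.
HB.instance Definition _ := GRing.Lmodule.on chains.

(* Unaffected circles consist of the same half-edges in both states. *)
Definition same_outside (p : 'I_(size e)) (b b' : generator) : bool :=
  [forall c : circle (gen_state b), forall c' : circle (gen_state b'),
     (val c == val c') && ~~ touches p (val c)
     ==> (gen_label b c == gen_label b' c')].

Definition local_coef (p : 'I_(size e)) (b b' : generator) : k :=
  let f := gen_label b in
  let f' := gen_label b' in
  match affected p (gen_state b), affected p (gen_state b') with
  | [:: c1; c2], [:: c'] => mul_coef (f c1) (f c2) (f' c')
  | [:: c], [:: c1; c2] => comul_coef (f c) (f' c1) (f' c2)
  | [:: c], [:: c'] => eta_coef (f c) (f' c')
  | _, _ => 0
  end.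

Definition edge_coef (p : 'I_(size e)) (b b' : generator) : k :=
  (same_outside p b b')%:R * local_coef p b b'.

Definition diff_coef (b b' : generator) : k :=
  \sum_(p | flip_at p (gen_state b) (gen_state b'))
    (-1) ^+ (\sum_(r < size e | (r < p)%N) gen_state b r)%N
    * edge_coef p b b'.

Definition diff (c : chains) : chains :=
  [ffun b' => \sum_b c b * diff_coef b b'].

Lemma diff_linear : linear diff.
Proof.
move=> a c d; apply/ffunP=> b'; rewrite !ffunE scaler_sumr -big_split /=.
by apply: eq_bigr => b _; rewrite !ffunE mulrDl -scalerAl.
Qed.
HB.instance Definition _ :=
  GRing.isLinear.Build k chains chains _ diff diff_linear.

(* The component [C^(i,j)]. *)
Definition homog (i j : int) (c : chains) : bool :=
  [forall b, (c b != 0) ==> ((hdeg b)%:Z == i) && (qdeg b == j)].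

Lemma homog_linear i j (a : k) (c d : chains) :
  homog i j c -> homog i j d -> homog i j (a *: c + d).
Proof.
move=> /forallP hc /forallP hd; apply/forallP => b; apply/implyP.
have [cb0|cb] := eqVneq (c b) 0; last by rewrite (implyP (hc b)).
have [db0|db] := eqVneq (d b) 0; last by rewrite (implyP (hd b)).
by rewrite !ffunE cb0 db0 scaler0 addr0 eqxx.
Qed.

Lemma homog0 i j : homog i j 0.
Proof. by apply/forallP => b; rewrite ffunE eqxx. Qed.

Definition bigraded_complex : Prop :=
  (forall i j c, homog i j c -> homog (i + 1) j (diff c)) /\
  (forall c, diff (diff c) = 0).

Section Homology.
Variables (i j : int).

Definition is_cycle : {pred chains} := fun c => homog i j c && (diff c == 0).

Lemma is_cycle_submod : submod_closed is_cycle.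
Proof.
split; first by rewrite unfold_in homog0 linear0 eqxx.
move=> a c d; rewrite !unfold_in => /andP[hc /eqP c0] /andP[hd /eqP d0].
by rewrite homog_linear //= diff_linear c0 d0 scaler0 addr0 eqxx.
Qed.
HB.instance Definition _ := GRing.isSubmodClosed.Build k chains is_cycle
  is_cycle_submod.

Record cycles := Cycle { cycle_val :> chains; _ : cycle_val \in is_cycle }.
HB.instance Definition _ := [isSub for cycle_val].
HB.instance Definition _ := [Choice of cycles by <:].
HB.instance Definition _ := [SubChoice_isSubLmodule of cycles by <:].

Definition is_boundary : {pred cycles} := fun z =>
  `[< exists2 b, homog (i - 1) j b & diff b = val z >].

Lemma is_boundary_submod : submod_closed is_boundary.
Proof.
split; first by apply/asboolP; exists 0; rewrite ?homog0 ?linear0.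
move=> a z w /asboolP[b hb dz] /asboolP[c hc dw]; apply/asboolP.
exists (a *: b + c); first exact: homog_linear.
by rewrite diff_linear dz dw.
Qed.

(* The boundaries that are cycles are all the boundaries, by the two parts of
   [bigraded_complex]. *)
Definition homology : lmodType k := mquot is_boundary_submod.

End Homology.
End Complex.

(* The Laurent polynomial lives in the field of fractions of [Z[q]]; [r i j] is
   the rank of the component of bidegree [(i, j)]; both sums have
   finite support. *)
Definition graded_euler (r : int -> int -> nat) : {fraction {poly int}} :=
  \sum_(i \in @classical_sets.setT int)
    (-1) ^ i * \sum_(j \in @classical_sets.setT int) qvar ^ j * (r i j)%:R.

(* Main.v *)
Require Import Defs.
From HB Require Import structures.
From mathcomp Require Import all_boot all_order all_fingroup all_algebra all_field.
From mathcomp Require Import zify ring.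
From mathcomp Require Import boolp fsbigop fraction.
From mathcomp Require classical_sets.

(* The square of the differential vanishes because every square face of the cube
   commutes.  To see this, deform [k[x]/(x^n)] to [x^n = tau^n] over an integral
   domain with a primitive [n]-th root of unity [zeta].  In the basis of
   colourings of the circles by the points [y = zeta^j tau], the map at a flipped
   edge vanishes unless the colours at its ends agree, and then multiplies by
   [1], [theta] or [theta^2] for a fusion, a one-to-one change or a splitting,
   where [theta = sqrt n * y^m].  This factor is [theta] times the ratio of the
   products of the [theta]'s over the circles after and before the flip, so the
   product of two such factors around a face does not depend on the order.
   Setting [tau = 0] gives the faces over the algebraic numbers, and since their
   coefficients are integers times powers of [sqrt n], over any [k].

   An equivalence of perfect matching graphs carries one cube to the other, up to
   the sign of the inversions of the induced bijection of the enumerations.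

   For the Euler characteristic over a ring with zero divisors, lift bases of the
   homology to cycles and take the mapping cone.  It is acyclic up to
   non-zero-divisors, hence has a homotopy [h] with [dh + hd = s] a
   non-zero-divisor; then [(d + h)^2 = s + h^2] is injective because [h^2] is
   nilpotent, so [d + h] embeds the even part into the odd part and conversely,
   and the two have the same rank. *)

Set Implicit Arguments.
Unset Strict Implicit.
Unset Printing Implicit Defensive.
Import GRing.Theory Num.Theory.
Local Open Scope ring_scope.

(** Comparing the two sides of a face directly would need a case analysis over all ways in which two
    edges can lie on the circles, one-to-one changes included. A semisimple algebra removes it:
    evaluation at distinct points diagonalises all three structure maps at once. The points are
    distinct only for [tau != 0], while at [tau = 0] evaluation is not injective; hence an
    indeterminate [tau], specialised after the comparison. The square root of [n] is forced: one
    side of a face may split and fuse a circle while the other changes it twice one-to-one, so eta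
    has to square to the handle operator, the coproduct followed by the product, which is
    multiplication by [n x^(2m)]. Colours are put on half-edges instead of circles, so that one
    colouring can be read in all the states of a face. Only free modules can be counted, and the
    cone is built from nothing but free modules. *)

Lemma even_fixfree_involution (T : finType) (f : T -> T) (A : {set T}) :
  {in A, forall x, [/\ f x \in A, f x != x & f (f x) = x]} -> ~~ odd #|A|.
Proof.
have [k] := ubnP #|A|; elim: k A => // k IH A leAk fA.
have [->|/set0Pn[x xA]] := eqVneq A set0; first by rewrite cards0.
have [fxA fxx ffx] := fA x xA.
have fxA' : f x \in A :\ x by rewrite !inE fxx.
rewrite (cardsD1 x) xA (cardsD1 (f x)) fxA' /= negbK.
apply: IH => [|y]; first by
  move: leAk; rewrite (cardsD1 x) xA (cardsD1 (f x)) fxA' /= => /ltnW.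
rewrite !inE => /and3P[yfx yx yA]; have [fyA fyy ffy] := fA y yA.
split=> //; rewrite fyA andbT; apply/andP; split.
  by apply: contraNneq yx => fyfx; rewrite -ffy fyfx ffx.
by apply: contraNneq yfx => fyx; rewrite -ffy fyx.
Qed.

(** * Free modules and acyclic complexes *)

(* Otherwise pad [A] with null columns into a square matrix [B].  The last column
   of a monic polynomial in [B] reduces to its constant coefficient, so if the
   polynomial annihilates [B] it is divisible by ['X], and ['X] can be cancelled:
   this contradicts the Cayley-Hamilton theorem. *)
Lemma injective_mulmx_leq (k : comNzRingType) (a b : nat) (A : 'M[k]_(a, b)) :
  (forall v : 'rV_a, v *m A = 0 -> v = 0) -> (a <= b)%N.
Proof.
case: a A => // a A injA; rewrite leqNgt; apply/negP => leba.
pose B : 'M[k]_a.+1 := \matrix_(i, j) if insub (j : nat) is Some j' then A i j' else 0.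
have Bmax (v : 'rV_a.+1) : (v *m B) 0 ord_max = 0 :> k.
  by rewrite mxE big1 // => i _; rewrite mxE insubF ?mulr0 //= ltnNge -ltnS leba.
have injB (v : 'rV_a.+1) : v *m B = 0 -> v = 0.
  move=> vB; apply: injA; apply/rowP => j.
  have ja : (j < a.+1)%N by apply: leq_trans (ltn_ord j) (ltnW leba).
  move/rowP/(_ (Ordinal ja)): vB; rewrite !mxE => vB.
  rewrite -[RHS]vB; apply: eq_bigr => i _; rewrite mxE /=; case: insubP => /= [u _ uj|].
    by congr (_ * A _ _); apply: val_inj.
  by rewrite ltn_ord.
have noroot : forall d (p : {poly k}), (size p <= d)%N -> p \is monic ->
    horner_mx B p <> 0.
  elim=> [|d IH] p szp pmon pB.
    by move: (monic_neq0 pmon); rewrite -size_poly_eq0 -leqn0 szp.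
  move: (monic_neq0 pmon) => p0.
  have [q [c pE]] : exists q c, p = q * 'X + c%:P.
    by elim/poly_ind: (p) => [|q c _]; [exists 0, 0; rewrite mul0r addr0|exists q, c].
  move: pB; rewrite pE rmorphD rmorphM /= horner_mx_X horner_mx_C => pB.
  have c0 : c = 0.
    have := congr1 (fun C : 'M_a.+1 => C ord_max ord_max) pB.
    have := Bmax (row ord_max (horner_mx B q)).
    by rewrite -row_mul mxE -[_ *m _]/(_ * _) !mxE eqxx mulr1n => ->; rewrite add0r.
  move: pB; rewrite c0 raddf0 addr0 => qB.
  have q0 : horner_mx B q = 0.
    apply/row_matrixP => i; rewrite row0; apply: injB.
    by rewrite -row_mul -[_ *m _]/(_ * _) qB row0.
  move: pmon szp; rewrite pE c0 raddf0 addr0 => pmon szp.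
  have q_neq0 : q != 0 by apply: contraNneq p0 => q00; rewrite pE q00 c0 mul0r raddf0 addr0.
  apply: (IH q) q0; last by rewrite monicMr ?monicX in pmon.
  by move: szp; rewrite size_mulX // ltnS.
exact: (noroot _ _ (leqnn _) (char_poly_monic B) (Cayley_Hamilton B)).
Qed.

Lemma injective_leq_card (k : comNzRingType) (I J : finType) (A : I -> J -> k) :
  (forall v : I -> k, (forall j, \sum_i v i * A i j = 0) -> forall i, v i = 0) ->
  (#|I| <= #|J|)%N.
Proof.
move=> injA.
apply: (@injective_mulmx_leq k _ _ (\matrix_(i, j) A (enum_val i) (enum_val j))).
move=> v vA; apply/rowP => i; rewrite mxE -[i]enum_valK.
apply: (injA (fun i => v 0 (enum_rank i))) => j.
move/rowP/(_ (enum_rank j)): vA; rewrite !mxE => vA; rewrite -[RHS]vA.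
rewrite (reindex (@enum_rank I)) /=; last by apply: onW_bij; apply: enum_rank_bij.
by apply: eq_bigr => l _; rewrite mxE !enum_rankK.
Qed.

Section FreeModule.
Variables (k : comNzRingType) (I : finType).
Local Notation V := {ffun I -> k^o}.

Definition ffun_basis (i : I) : V := [ffun l => (l == i)%:R].

Lemma ffun_basisE (v : V) : v = \sum_i v i *: ffun_basis i.
Proof.
apply/ffunP => l; rewrite sum_ffunE (bigD1 l) //= big1 => [|i il].
  by rewrite !ffunE eqxx addr0 /GRing.scale /= mulr1.
by rewrite !ffunE eq_sym (negPf il) /GRing.scale /= mulr0.
Qed.

Lemma linear_ffunE (W : lmodType k) (D : {linear V -> W}) (v : V) :
  D v = \sum_i v i *: D (ffun_basis i).
Proof. by rewrite [in LHS](ffun_basisE v) linear_sum; apply: eq_bigr => i _;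
  rewrite linearZ. Qed.

Definition lin_ext (W : lmodType k) (h : I -> W) (v : V) : W := \sum_i v i *: h i.

Lemma lin_ext_is_linear (W : lmodType k) (h : I -> W) : linear (lin_ext h).
Proof.
move=> a u v; rewrite /lin_ext scaler_sumr -big_split /=; apply: eq_bigr => i _.
by rewrite !ffunE scalerDl scalerA.
Qed.
HB.instance Definition _ (W : lmodType k) (h : I -> W) :=
  GRing.isLinear.Build k V W _ (lin_ext h) (lin_ext_is_linear h).

Lemma lin_ext_basis (W : lmodType k) (h : I -> W) i : lin_ext h (ffun_basis i) = h i.
Proof.
rewrite /lin_ext (bigD1 i) //= big1 => [|l li]; first by rewrite ffunE eqxx scale1r addr0.
by rewrite ffunE (negPf li) scale0r.
Qed.

End FreeModule.

Section AcyclicComplex.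
Variables (k : comNzRingType) (I : finType) (deg : I -> nat).
Local Notation V := {ffun I -> k^o}.
Local Notation delta := (@ffun_basis k I).
Variable D : {linear V -> V}.
Hypothesis D_deg : forall i l, D (delta i) l != 0 -> deg l = (deg i).+1.
Hypothesis D_sq : forall v, D (D v) = 0.
Hypothesis D_acyclic : forall v, D v = 0 ->
  exists (s : k) (w : V), GRing.lreg s /\ s *: v = D w.

Local Lemma coordE (F : {linear V -> V}) (v : V) l : F v l = \sum_i v i * F (delta i) l.
Proof. by rewrite linear_ffunE sum_ffunE; apply: eq_bigr => i _; rewrite ffunE. Qed.

(** The homotopy is built from the top degree down. Since [D] raises the degree, [h] is already
    defined on [D (delta i)] when [deg i = T]; the defect [z i] is then a cycle, and acyclicity
    makes a regular multiple of it a boundary. *)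
Local Lemma homotopy_step T :
  (exists (s : k) (h : I -> V), [/\ GRing.lreg s,
     forall i l, h i l != 0 -> deg i = (deg l).+1 &
     forall i, (T < deg i)%N ->
       lin_ext h (D (delta i)) + D (h i) = s *: delta i]) ->
  exists (s : k) (h : I -> V), [/\ GRing.lreg s,
     forall i l, h i l != 0 -> deg i = (deg l).+1 &
     forall i, (T <= deg i)%N ->
       lin_ext h (D (delta i)) + D (h i) = s *: delta i].
Proof.
case=> s [h [sreg h_deg hD]].
pose z i : V := s *: delta i - lin_ext h (D (delta i)).
have key (w : V) : \sum_l w l *: (s *: delta l - lin_ext h (D (delta l)))
    = s *: w - lin_ext h (D w).
  rewrite (linear_ffunE D w) (linear_sum (lin_ext h)) [w in _ *: w](ffun_basisE w).
  rewrite scaler_sumr -sumrB; apply: eq_bigr => l _.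
  by rewrite scalerBr; congr (_ - _); [rewrite !scalerA mulrC | rewrite linearZ].
have Dz i : deg i = T -> D (z i) = 0.
  move=> iT; rewrite linearB linearZ /= /lin_ext linear_sum /=.
  transitivity (s *: D (delta i) - \sum_l D (delta i) l *: (s *: delta l - lin_ext h (D
    (delta l)))).
    congr (_ - _); apply: eq_bigr => l _; rewrite linearZ /=.
    have [->|nz] := eqVneq (D (delta i) l) 0; first by rewrite !scale0r.
    have := hD l; rewrite (D_deg nz) iT ltnSn => /(_ isT) <-.
    by rewrite [X in _ = _ *: X]addrAC subrr add0r.
  by rewrite key D_sq linear0 subr0 subrr.
have zT i l : deg i = T -> z i l != 0 -> deg l = T.
  move=> iT; rewrite !ffunE.
  have [->//|li] := eqVneq l i.
  rewrite scaler0 add0r oppr_eq0 sum_ffunE => nz.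
  case: (pickP (fun m => D (delta i) m * h m l != 0)) => [m|no].
    move=> nzm; have nD : D (delta i) m != 0 by apply: contraNneq nzm => ->; rewrite mul0r.
    have nh : h m l != 0 by apply: contraNneq nzm => ->; rewrite mulr0.
    by apply: succn_inj; rewrite -(h_deg _ _ nh) (D_deg nD) iT.
  by case/eqP: nz; rewrite big1 // => m _; rewrite ffunE; move/negbFE/eqP: (no m).
(* The primitive given by acyclicity need not be homogeneous; its part of degree [T - 1] has the
   same image in degree [T], where [z i] lives. The successor avoids a truncated subtraction at
   [T = 0]. *)
pose pr (v : V) : V := [ffun l => if (deg l).+1 == T then v l else 0].
have Dpr v l : D (pr v) l = if deg l == T then D v l else 0.
  rewrite coordE [D v l]coordE; case: eqP => lT.
    apply: eq_bigr => i _; rewrite ffunE; case: eqP => // iT.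
    have [->|/D_deg il] := eqVneq (D (delta i) l) 0; first by rewrite !mulr0.
    by case: iT; rewrite -il.
  rewrite big1 // => i _; rewrite ffunE; case: eqP => [iT|_]; last by rewrite mul0r.
  have [->|/D_deg il] := eqVneq (D (delta i) l) 0; first by rewrite !mulr0.
  by case: lT; rewrite il.
have /fin_all_exists[u uP] i : exists u : k * V,
    GRing.lreg u.1 /\ (deg i = T -> u.1 *: z i = D u.2).
  have [iT|iT] := eqVneq (deg i) T.
    by have [t [w [treg tz]]] := D_acyclic (Dz i iT); exists (t, w); split.
  by exists (1, 0); split; [exact: lreg1 | move/eqP; rewrite (negPf iT)].
(* Each [i] comes with its own multiplier. Their product is a common one, by which the part of [h]
   already built is rescaled too. *)
pose t := \prod_i (u i).1; pose t' i := \prod_(j | j != i) (u j).1.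
have tE i : t = t' i * (u i).1 by rewrite /t (bigD1 i) //= mulrC.
have treg : GRing.lreg t.
  rewrite /t; elim/big_ind: _ => [|a b|i _]; [exact: lreg1|exact: lregM|exact: (uP i).1].
pose h' i : V := if (T < deg i)%N then t *: h i
  else if deg i == T then t' i *: pr (u i).2 else 0.
have extE i : (T <= deg i)%N -> lin_ext h' (D (delta i)) = t *: lin_ext h (D (delta i)).
  move=> iT; rewrite /lin_ext scaler_sumr; apply: eq_bigr => l _.
  have [->|/D_deg il] := eqVneq (D (delta i) l) 0; first by rewrite !scale0r scaler0.
  by rewrite /h' il ltnS iT !scalerA mulrC.
exists (t * s), h'; split=> [|i l|i Ti]; first exact: lregM.
  rewrite /h'; case: ifP => _.
    by rewrite ffunE => nz; apply: h_deg; apply: contraNneq nz => ->; rewrite scaler0 eqxx.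
  case: (deg i =P T) => [iT|_]; last by rewrite ffunE eqxx.
  by rewrite !ffunE; case: ((deg l).+1 =P T) => [->|_] //; rewrite scaler0 eqxx.
rewrite extE //; move: Ti; rewrite leq_eqVlt => /orP[/eqP Ti|Ti]; last first.
  by rewrite /h' Ti linearZ /= -scalerDr hD // scalerA.
rewrite /h' -Ti ltnn eqxx linearZ /=.
have -> : D (pr (u i).2) = (u i).1 *: z i.
  rewrite (uP i).2 //; apply/ffunP => l; rewrite Dpr; case: eqP => // lT.
  rewrite -(uP i).2 // ffunE; have [->|nz] := eqVneq (z i l) 0; first by rewrite scaler0.
  by case: lT; apply: zT nz.
by rewrite [t' i *: _]scalerA -tE -scalerDr addrC subrK scalerA.
Qed.

Local Lemma homotopy : exists (s : k) (h : I -> V), [/\ GRing.lreg s,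
     forall i l, h i l != 0 -> deg i = (deg l).+1 &
     forall v, lin_ext h (D v) + D (lin_ext h v) = s *: v].
Proof.
pose N := \max_i deg i.
suff /(_ N.+1) : forall j, exists (s : k) (h : I -> V), [/\ GRing.lreg s,
     forall i l, h i l != 0 -> deg i = (deg l).+1 &
     forall i, (N.+1 - j <= deg i)%N ->
       lin_ext h (D (delta i)) + D (h i) = s *: delta i].
  rewrite subnn => -[s [h [sreg h_deg hD]]]; exists s, h; split=> // v.
  rewrite (linear_ffunE D v) (linear_sum (lin_ext h)) [lin_ext h v]/lin_ext (linear_sum D).
  rewrite [in RHS](ffun_basisE v) scaler_sumr -big_split; apply: eq_bigr => i _ /=.
  rewrite [lin_ext h _]linearZ [D (v i *: _)]linearZ -scalerDr hD //.
  by rewrite !scalerA mulrC.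
elim=> [|j IH].
  exists 1, (fun=> 0); split=> [|i l|i]; first exact: lreg1.
    by rewrite ffunE eqxx.
  by rewrite subn0 ltnNge leq_bigmax.
have [le|lt] := leqP N.+1 j.
  by case: IH => s [h [? ? H]]; exists s, h; split=> // i _; apply: H; rewrite (eqP le).
by apply: homotopy_step; rewrite -subSS -subSn // in IH *.
Qed.

(* [D + h] squares to [s + h^2], where [h^2] lowers the degree by 2. *)
Lemma acyclic_leq (b : bool) :
  (#|[pred i | odd (deg i) == b]| <= #|[pred i | odd (deg i) != b]|)%N.
Proof.
have [s [h [sreg h_deg hD]]] := homotopy.
pose B v := D v + lin_ext h v.
have BE v l : B v l = \sum_i v i * (D (delta i) l + h i l).
  rewrite /B ffunE coordE (coordE (lin_ext h)) -big_split; apply: eq_bigr => i _ /=.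
  by rewrite lin_ext_basis mulrDr.
have Binj v : B v = 0 -> v = 0.
  move=> Bv; have sv : s *: v + lin_ext h (lin_ext h v) = 0.
    have := congr1 D Bv; rewrite linear0 /B linearD D_sq add0r => Dh.
    have := congr1 (lin_ext h) Bv; rewrite linear0 /B linearD => <-.
    by rewrite -hD Dh addr0.
  pose N := \max_i deg i.
  (* By [sv], a coordinate of [s *: v] in degree [d] depends only on the coordinates of [v] in
     degree [d + 2]: they vanish from the top degree down. *)
  suff vN j : forall i, (N < deg i + j)%N -> v i = 0.
    by apply/ffunP => i; rewrite (vN N.+1) ?ffunE // leq_addl.
  elim: j => [|j IH] i; first by rewrite addn0 ltnNge leq_bigmax.
  move=> ij; apply: sreg; rewrite mulr0.
  move/ffunP/(_ i): sv; rewrite !ffunE (coordE (lin_ext h)) big1 ?addr0 // => l _.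
  rewrite /= lin_ext_basis; have [->|/h_deg li] := eqVneq (h l i) 0; first exact: mulr0.
  rewrite (coordE (lin_ext h)) big1 ?mul0r // => m _; rewrite /= lin_ext_basis.
  have [->|/h_deg ml] := eqVneq (h m l) 0; first exact: mulr0.
  by rewrite IH ?mul0r // ml li addSn ltnW // addSnnS.
rewrite -[X in (X <= _)%N]card_sig -[X in (_ <= X)%N]card_sig.
apply: (@injective_leq_card k _ _ (fun i l => B (delta (val i)) (val l))) => v vB i.
pose w : V := \sum_i v i *: delta (val i).
have wE (l : {i | odd (deg i) == b}) : w (val l) = v l.
  rewrite /w sum_ffunE (bigD1 l) //= big1 => [|m ml]; rewrite !ffunE.
    by rewrite eqxx addr0 -[RHS]mulr1.
  by rewrite -(inj_eq val_inj) eq_sym in ml; rewrite (negPf ml) scaler0.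
have bN : (~~ b == b) = false by case: (b).
rewrite -wE (Binj w) ?ffunE //; apply/ffunP => l; rewrite [RHS]ffunE.
have BwE : B w l = \sum_i v i * B (delta (val i)) l.
  rewrite /B /w !linear_sum -big_split sum_ffunE; apply: eq_bigr => m _ /=.
  by rewrite !linearZ /= -scalerDr ffunE.
have [lb|lb] := boolP (odd (deg l) == b); last first.
  by rewrite BwE; apply: (vB (exist _ l lb)).
rewrite BwE big1 // => m _; rewrite /B ffunE lin_ext_basis.
have /= /eqP mb := valP m.
have [->|/D_deg ml] := eqVneq (D (delta (val m)) l) 0; last first.
  by move: lb; rewrite ml /= mb bN.
rewrite add0r; have [->|/h_deg ml] := eqVneq (h (val m) l) 0; first exact: mulr0.
by move: mb; rewrite ml /= (eqP lb) => /esym/eqP; rewrite eq_sym bN.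
Qed.

Lemma acyclic_card : #|[pred i | odd (deg i)]| = #|[pred i | ~~ odd (deg i)]|.
Proof.
apply/eqP; rewrite eqn_leq; apply/andP; split.
  have := acyclic_leq true; congr (_ <= _)%N; apply: eq_card => i; rewrite !inE /=.
    by rewrite eqb_id.
  by case: odd.
have := acyclic_leq false; congr (_ <= _)%N; apply: eq_card => i; rewrite !inE /=.
  by case: odd.
by case: odd.
Qed.

End AcyclicComplex.

(** * Sums over labellings and the deformed Frobenius algebra *)

Section Updates.
Variables (C I : finType) (g : {ffun C -> I}).

Definition updated (c : C) (i : I) : {ffun C -> I} :=
  [ffun z => if z == c then i else g z].

Lemma updatedE c i z : updated c i z = if z == c then i else g z.
Proof. exact: ffunE. Qed.

End Updates.

Section UpdateSums.
Variables (V : nmodType) (C I : finType) (g : {ffun C -> I}).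
Implicit Types (c : C) (F : {ffun C -> I} -> V).

Lemma sum_updated c F :
  \sum_(f : {ffun C -> I} | [forall z, (z \notin [:: c]) ==> (f z == g z)]) F f
  = \sum_i F (updated g c i).
Proof.
rewrite (reindex_onto (updated g c) (fun f : {ffun C -> I} => f c)) /=.
  apply: eq_bigl => i; rewrite ffunE eqxx eqxx andbT; apply/forallP => z.
  by rewrite inE ffunE; case: eqP => //= _; rewrite eqxx.
move=> f /forallP fg; apply/ffunP => z; rewrite ffunE; case: eqP => [->//|/eqP zc].
by have := fg z; rewrite inE zc /= => /eqP.
Qed.

Lemma sum_updated2 c1 c2 F : c1 != c2 ->
  \sum_(f : {ffun C -> I} | [forall z, (z \notin [:: c1; c2]) ==> (f z == g z)]) F f
  = \sum_i \sum_j F (updated (updated g c1 i) c2 j).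
Proof.
move=> c12; rewrite pair_bigA /=.
rewrite (reindex_onto (fun ij : I * I => updated (updated g c1 ij.1) c2 ij.2)
  (fun f : {ffun C -> I} => (f c1, f c2))) /=.
  apply: eq_bigl => -[i j] /=; rewrite !ffunE !eqxx (negPf c12) eqxx andbT; apply/forallP => z.
  by rewrite !inE !ffunE; case: (z == c1); case: (z == c2) => //=; rewrite eqxx.
move=> f /forallP fg; apply/ffunP => z; rewrite !ffunE /=.
have := fg z; rewrite !inE; case: (z =P c2) => [->//|_]; case: (z =P c1) => [->//|_] /=.
by move/eqP.
Qed.

End UpdateSums.

(** A polynomial of degree less than [n] in each variable is determined by its values on a grid. Up
    to the factors [kap], [z] inverts the Vandermonde matrix of the [y j], and its tensor power
    extracts one coefficient of [u] at a time. *)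
Lemma ffun_grid_inj (R : idomainType) (n : nat) (C : finType) (y : 'I_n -> R)
    (z : 'I_n -> 'I_n -> R) (kap : 'I_n -> R) (u : {ffun C -> 'I_n} -> R) :
  (forall i l : 'I_n, \sum_j z j l * y j ^+ i = (i == l)%:R * kap l) ->
  (forall l, kap l != 0) ->
  (forall d : {ffun C -> 'I_n}, \sum_f u f * \prod_c y (d c) ^+ f c = 0) ->
  forall f, u f = 0.
Proof.
move=> zy kap0 u0 l.
have : \sum_(d : {ffun C -> 'I_n}) (\prod_c z (d c) (l c)) *
    (\sum_f u f * \prod_c y (d c) ^+ f c) = 0.
  by rewrite big1 // => d _; rewrite u0 mulr0.
under eq_bigr do rewrite mulr_sumr.
rewrite exchange_big /= (bigD1 l) //= [X in _ + X]big1 ?addr0 => [|f fl].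
  under eq_bigr do rewrite mulrCA -big_split /=.
  rewrite -mulr_sumr -(bigA_distr_bigA (fun c j => z j (l c) * y j ^+ l c)) /=.
  under eq_bigr do rewrite zy eqxx mul1r.
  by move/eqP; rewrite mulf_eq0 => /orP[/eqP//|/prodf_eq0[c _]]; rewrite (negPf (kap0 _)).
under eq_bigr do rewrite mulrCA -big_split /=.
rewrite -mulr_sumr -(bigA_distr_bigA (fun c j => z j (l c) * y j ^+ f c)) /=.
case: (pickP (fun c => f c != l c)) => [c fc|fl'].
  by rewrite (bigD1 c) //= zy (negPf fc) !mul0r mulr0.
by case/eqP: fl; apply/ffunP => c; move/negbFE/eqP: (fl' c).
Qed.

(** The booleans tell whether the two unmatched half-edges at one end of the flipped edge lie on the
    same circle, before and after the flip. They cannot be separated both times, so there is no case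
    with two circles on each side. *)
Variant flip_shape (S T : eqType) : seq S -> seq T -> bool -> bool -> Type :=
  | Merging c1 c2 c' of c1 != c2 : flip_shape [:: c1; c2] [:: c'] false true
  | Splitting c c1 c2 of c1 != c2 : flip_shape [:: c] [:: c1; c2] true false
  | Twisting c c' : flip_shape [:: c] [:: c'] true true.

Lemma big_uniq_split (A : Type) (idx : A) (op : Monoid.com_law idx) (C : finType)
    (s : seq C) (F : C -> A) : uniq s ->
  \big[op/idx]_c F c = op (\big[op/idx]_(c <- s) F c) (\big[op/idx]_(c | c \notin s) F c).
Proof. by move=> us; rewrite (bigID (fun c : C => c \in s)) (big_uniq _ us). Qed.

(** The case distinction of [local_coef] with the structure constants as parameters, so that the
    deformed algebra and its specialisations share one treatment. *)
Definition local_edge (n : nat) (A : pzSemiRingType) (mu de : 'I_n -> 'I_n -> 'I_n -> A)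
    (et : 'I_n -> 'I_n -> A) (S T : finType) (s : seq S) (t : seq T)
    (f : {ffun S -> 'I_n}) (f' : {ffun T -> 'I_n}) : A :=
  match s, t with
  | [:: c1; c2], [:: c'] => mu (f c1) (f c2) (f' c')
  | [:: c], [:: c1; c2] => de (f c) (f' c1) (f' c2)
  | [:: c], [:: c'] => et (f c) (f' c')
  | _, _ => 0
  end.

Section LocalEdge.
Variables (A : comNzRingType) (n : nat).
Variables (mu de : 'I_n -> 'I_n -> 'I_n -> A) (et : 'I_n -> 'I_n -> A).
Variables (y theta : 'I_n -> A).
Hypothesis mu_y : forall i j g, \sum_l mu i j l * y g ^+ l = y g ^+ i * y g ^+ j.
Hypothesis et_y : forall i g, \sum_l et i l * y g ^+ l = theta g * y g ^+ i.
Hypothesis de_y : forall l g g', \sum_i \sum_j de l i j * (y g ^+ i * y g' ^+ j) =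
  (g == g')%:R * theta g ^+ 2 * y g ^+ l.
Variables (S T : finType) (s : seq S) (t : seq T) (ms mt : bool).
Hypothesis shape : flip_shape s t ms mt.
(* [kap] and [lam] colour the circles before and after the flip, and [g], [g']
   are the colours at the two half-edges of one end of the flipped edge. *)
Variables (kap : S -> 'I_n) (lam : T -> 'I_n) (g g' : 'I_n).
Hypothesis lam_t : (if mt then (g == g') && all (fun c => lam c == g) t
  else perm_eq (map lam t) [:: g; g']).
Hypothesis kap_s : g = g' -> all (fun c => kap c == g) s.

Definition local_factor : A := if ms then if mt then theta g else theta g ^+ 2 else 1.

(** The unaffected circles contribute a common factor [U]; what remains is one of the three
    evaluation hypotheses. When the two half-edges share a circle after the flip their colours
    agree, so only a splitting can produce zero, through the diagonal factor in [de_y]. *)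
Lemma local_edge_colour (f : {ffun S -> 'I_n}) (f0 : {ffun T -> 'I_n}) :
  \prod_(c | c \notin s) y (kap c) ^+ f c = \prod_(c | c \notin t) y (lam c) ^+ f0 c ->
  \sum_(f' : {ffun T -> 'I_n}) [forall c, (c \notin t) ==> (f' c == f0 c)]%:R *
      local_edge mu de et s t f f' * \prod_c y (lam c) ^+ f' c =
  (g == g')%:R * local_factor * \prod_c y (kap c) ^+ f c.
Proof.
set U := \prod_(c | c \notin t) _ => UE.
transitivity (\sum_(f' : {ffun T -> 'I_n} | [forall c, (c \notin t) ==> (f' c == f0 c)])
    local_edge mu de et s t f f' * (\prod_(c <- t) y (lam c) ^+ f' c) * U).
  rewrite [RHS]big_mkcond; apply: eq_bigr => f' _; case: ifP => [/forallP ff0|_].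
    rewrite mul1r -mulrA (@big_uniq_split _ _ _ _ t); last first.
      by case: shape => //= *; rewrite !inE !andbT.
    congr (_ * (_ * _)); apply: eq_bigr => c ct.
    by have := ff0 c; rewrite ct => /eqP->.
  by rewrite !mul0r.
rewrite (@big_uniq_split _ _ _ _ s); last by case: shape => //= *; rewrite !inE !andbT.
rewrite UE mulrA -mulr_suml; congr (_ * _); rewrite /local_factor {UE U}.
move: lam_t kap_s; case: shape => [c1 c2 c' c12|c c1 c2 c12|c c'] /=.
- rewrite andbT => /andP[/eqP gg /eqP lg] /(_ gg) /and3P[/eqP k1 /eqP k2 _].
  rewrite sum_updated -gg eqxx !mul1r big_cons big_seq1 k1 k2 -mu_y.
  by apply: eq_bigr => l _; rewrite big_seq1 updatedE eqxx lg.
- move=> lam_t' kap_s'; rewrite sum_updated2 // big_seq1.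
  transitivity (\sum_i \sum_j de (f c) i j * (y (lam c1) ^+ i * y (lam c2) ^+ j)).
    apply: eq_bigr => i _; apply: eq_bigr => j _.
    by rewrite big_cons big_seq1 !updatedE !eqxx (negPf c12).
  rewrite de_y; have [gg|gg] := eqVneq g g'.
    have /andP[/eqP k1 _] := kap_s' gg.
    have lg : all (pred1 g) [:: lam c1; lam c2] by rewrite (perm_all _ lam_t') -gg /= eqxx.
    by move: lg => /and3P[/eqP-> /eqP-> _]; rewrite eqxx k1.
  have := perm_uniq lam_t'; rewrite /= !inE !andbT gg => /negPf->.
  by rewrite !mul0r.
- rewrite andbT => /andP[/eqP gg /eqP lg] /(_ gg) /andP[/eqP k1 _].
  rewrite sum_updated -gg eqxx mul1r big_seq1 k1 -et_y.
  by apply: eq_bigr => l _; rewrite big_seq1 updatedE eqxx lg.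
Qed.

(** The ratio of the two circle weights is [theta g] to the change in the number of circles. The
    products are kept on both sides because [A] has no division. *)
Lemma local_factor_weight : g = g' ->
  \prod_(c | c \notin s) theta (kap c) = \prod_(c | c \notin t) theta (lam c) ->
  local_factor * \prod_c theta (kap c) = theta g * \prod_c theta (lam c).
Proof.
move=> gg UE; rewrite (@big_uniq_split _ _ _ _ s); last by case: shape => //= *;
  rewrite !inE !andbT.
rewrite [in RHS](@big_uniq_split _ _ _ _ t); last by case: shape => //= *; rewrite !inE !andbT.
rewrite UE !mulrA; congr (_ * _); rewrite /local_factor {UE}.
have lt : all (fun c => lam c == g) t.
  move: lam_t; rewrite -gg eqxx; case: (mt) => //= /perm_mem lamt.
  apply/allP => c ct; have := map_f lam ct.
  by rewrite lamt !inE orbb.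
move: lt (kap_s gg); case: shape => [c1 c2 c' c12|c c1 c2 c12|c c'] /=.
- move=> /andP[/eqP e3 _] /and3P[/eqP e1 /eqP e2 _].
  by rewrite big_cons !big_seq1 e1 e2 e3 mul1r.
- by move=> /and3P[/eqP e1 /eqP e2 _] /andP[/eqP e3 _];
    rewrite !big_cons !big_nil !mulr1 e1 e2 e3 expr2 mulrA.
- by move=> /andP[/eqP e1 _] /andP[/eqP e2 _]; rewrite !big_seq1 e1 e2.
Qed.

End LocalEdge.

Lemma sum_unity_powers (A : idomainType) (n : nat) (w : A) : (0 < n)%N ->
  w ^+ n = 1 -> \sum_(i < n) w ^+ i = if w == 1 then n%:R else 0.
Proof.
move=> n0 wn; case: eqP => [->|/eqP w1].
  by under eq_bigr do rewrite expr1n; rewrite sumr_const card_ord.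
apply/eqP; have := subrX1 w n; rewrite wn subrr => /esym/eqP.
by rewrite mulf_eq0 subr_eq0 (negPf w1).
Qed.

Lemma mod_sub_eq0 (n : nat) (i l : 'I_n) : ((i + (n - l)) %% n == 0)%N = (i == l).
Proof.
rewrite -(inj_eq val_inj) /=; have il := ltn_ord i; have ll := ltn_ord l.
case: (ltngtP i l) => [lt|gt|->]; last by rewrite subnKC ?modnn // ltnW.
  by rewrite modn_small; lia.
by rewrite (_ : (i + (n - l) = n + (i - l))%N); [rewrite modnDl modn_small|]; lia.
Qed.

(* The Frobenius algebra [A[x]/(x^n - tau^n)], which deforms the case [tau = 0]:
   its points are [zeta^j tau]. *)
Section Deformation.
Variables (A : idomainType) (n : nat) (zeta tau s : A).
Hypotheses (n_gt0 : (0 < n)%N) (zetaP : n.-primitive_root zeta).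
Hypotheses (tau_neq0 : tau != 0) (n_neq0 : n%:R != 0 :> A) (s_sq : s ^+ 2 = n%:R).
Let m := n./2.

(** The residue [l] of [i + j] is at most [i + j], so the truncated subtraction is exact whenever
    the congruence holds. *)
Definition deformed_mul (i j l : 'I_n) : A :=
  (l == i + j %[mod n])%N%:R * tau ^+ (i + j - l).
Definition deformed_comul (l i j : 'I_n) : A :=
  (i + j == l + m.*2 %[mod n])%N%:R * tau ^+ (l + m.*2 - (i + j)).
Definition deformed_eta (i l : 'I_n) : A :=
  s * ((l == i + m %[mod n])%N%:R * tau ^+ (i + m - l)).
Definition point (j : 'I_n) : A := zeta ^+ j * tau.
(** Its square is the value at the [j]-th point of the handle element [n x^(2m)], the product
    applied to Delta(1). *)
Definition half_handle (j : 'I_n) : A := s * point j ^+ m.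

Lemma zeta_neq0 : zeta != 0.
Proof.
apply/eqP => z0; have := prim_expr_order zetaP; rewrite z0 expr0n gtn_eqF //.
by move/eqP; rewrite eq_sym oner_eq0.
Qed.

Lemma s_neq0 : s != 0.
Proof. by apply: contraNneq n_neq0 => s0; rewrite -s_sq s0 expr0n. Qed.

Lemma point_neq0 j : point j != 0.
Proof. by rewrite mulf_neq0 ?expf_neq0 // zeta_neq0. Qed.

Lemma half_handle_neq0 j : half_handle j != 0.
Proof. by rewrite mulf_neq0 ?s_neq0 // expf_neq0 // point_neq0. Qed.

Lemma zeta_mod i k : i = k %[mod n] -> zeta ^+ i = zeta ^+ k.
Proof. by move=> ik; rewrite -(prim_expr_mod zetaP i) ik prim_expr_mod. Qed.

Lemma point_mod g i k : i = k %[mod n] -> (i <= k)%N ->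
  tau ^+ (k - i) * point g ^+ i = point g ^+ k.
Proof.
move=> ik lik; rewrite /point !exprMn mulrCA -exprD subnK //; congr (_ * _).
by rewrite -!exprM; apply: zeta_mod; rewrite -modnMmr ik modnMmr.
Qed.

Lemma sum_mod (K : nat) (F : 'I_n -> A) :
  \sum_(l < n) (l == K %[mod n])%N%:R * F l = F (Ordinal (ltn_pmod K n_gt0)).
Proof.
rewrite (bigD1 (Ordinal (ltn_pmod K n_gt0))) //= modn_mod eqxx mul1r big1 ?addr0 // => l.
rewrite -(inj_eq val_inj) /= => lK.
by rewrite modn_small // (negPf lK) mul0r.
Qed.

Lemma deformed_mul_point i j g :
  \sum_l deformed_mul i j l * point g ^+ l = point g ^+ i * point g ^+ j.
Proof.
under eq_bigr do rewrite /deformed_mul -mulrA.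
by rewrite sum_mod /= point_mod ?modn_mod ?leq_mod // exprD.
Qed.

Lemma deformed_eta_point i g :
  \sum_l deformed_eta i l * point g ^+ l = half_handle g * point g ^+ i.
Proof.
under eq_bigr do rewrite /deformed_eta -!mulrA.
rewrite -mulr_sumr sum_mod /= point_mod ?modn_mod ?leq_mod //.
by rewrite /half_handle -mulrA -exprD addnC.
Qed.

Lemma deformed_comul_point l g g' :
  \sum_i \sum_j deformed_comul l i j * (point g ^+ i * point g' ^+ j) =
  (g == g')%:R * half_handle g ^+ 2 * point g ^+ l.
Proof.
pose K := (l + m.*2)%N.
(* The ratio of the two points. For each [i] a single [j] contributes, and the sum over [i] becomes
   the geometric sum of a root of unity, equal to [n] or 0. *)
pose w := zeta ^+ g * zeta ^+ (n - g').
have wn : w ^+ n = 1.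
  by rewrite /w -exprD exprAC (prim_expr_order zetaP) expr1n.
have w1 : (w == 1) = (g == g').
  by rewrite /w -exprD -(expr0 zeta) (eq_prim_root_expr zetaP) mod0n mod_sub_eq0.
transitivity (\sum_(i < n) w ^+ i * (point g' ^+ K)).
  apply: eq_bigr => i _.
  have [j jE] : exists j : 'I_n, (i + j = K %[mod n])%N.
    exists (Ordinal (ltn_pmod (K + (n - i)) n_gt0)) => /=.
    by rewrite modnDmr addnCA subnKC ?modnDr // ltnW.
  rewrite (bigD1 j) //= big1 ?addr0 => [|j' j'j]; last first.
    rewrite /deformed_comul -/K -jE eqn_modDl !modn_small //.
    by rewrite (inj_eq val_inj) (negPf j'j) !mul0r.
  rewrite /deformed_comul -/K jE eqxx mul1r.
  (* Otherwise the congruence would give [i + j >= K + n], hence at least [2n - 1] because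
     [2m >= n - 1]; but [i + j <= 2n - 2]. So no term of the coproduct has a truncated exponent. *)
  have ijK : (i + j <= K)%N.
    rewrite leqNgt; apply/negP => ltK.
    have : (n %| i + j - K)%N by rewrite -eqn_mod_dvd ?(ltnW ltK) // jE.
    move=> /dvdnP[q qE]; have := ltn_ord i; have := ltn_ord j.
    move: qE ltK; rewrite /K /m; case: q => [|q]; lia.
  have -> : point g ^+ i * point g' ^+ j = w ^+ i * (point g' ^+ (i + j)).
    have -> : point g = w * point g'.
      rewrite /point /w -mulrA [zeta ^+ (n - g') * _]mulrA -exprD.
      by rewrite subnK ?(prim_expr_order zetaP) ?mul1r // ltnW.
    by rewrite exprMn exprD mulrA.
  by rewrite mulrCA point_mod.
rewrite -mulr_suml sum_unity_powers // w1; case: eqP => [->|_]; last by rewrite !mul0r.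
rewrite mul1r [half_handle _ ^+ 2]exprMn s_sq -exprM -mulrA -exprD.
by rewrite /K addnC -mul2n mulnC.
Qed.

(** The inverse discrete Fourier transform [zeta^(-j l)], up to normalisation, with [n - l] standing
    for [-l]. *)
Definition dual_point (j l : 'I_n) : A := zeta ^+ (j * (n - l)).

Lemma dual_point_point (i l : 'I_n) :
  \sum_j dual_point j l * point j ^+ i = (i == l)%:R * (n%:R * tau ^+ l).
Proof.
pose w := zeta ^+ (n - l + i).
have wn : w ^+ n = 1 by rewrite /w exprAC (prim_expr_order zetaP) expr1n.
have w1 : (w == 1) = (i == l).
  by rewrite /w -(expr0 zeta) (eq_prim_root_expr zetaP) mod0n addnC mod_sub_eq0.
transitivity (\sum_(j < n) w ^+ j * tau ^+ i).
  apply: eq_bigr => j _; rewrite /dual_point /point exprMn mulrA; congr (_ * _).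
  by rewrite /w -!exprM -exprD -mulnDr mulnC.
rewrite -mulr_suml sum_unity_powers // w1; case: eqP => [->|_]; last by rewrite !mul0r.
by rewrite mul1r.
Qed.

End Deformation.

(** The diagonal is a separate hypothesis because [x = - x] does not give [x = 0] in characteristic
    2. *)
Lemma antisymmetric_sum (V : zmodType) (n : nat) (t : 'I_n -> 'I_n -> V) :
  (forall p, t p p = 0) -> (forall p q, p != q -> t p q = - t q p) ->
  \sum_p \sum_q t p q = 0.
Proof.
move=> t0 tN.
transitivity (\sum_(p < n) \sum_(q : 'I_n | (q < p)%N) t p q + \sum_(p < n) \sum_(q : 'I_n |
  (p < q)%N) t p q).
  rewrite -big_split; apply: eq_bigr => p _ /=.
  rewrite (bigID (fun q : 'I_n => (q < p)%N)) /=; congr (_ + _).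
  rewrite (bigD1 p) ?ltnn //= t0 add0r; apply: eq_bigl => q.
  by rewrite -leqNgt [RHS]ltn_neqAle andbC eq_sym.
rewrite [X in _ + X](exchange_big_dep predT) //= -big_split big1 // => p _ /=.
rewrite -big_split big1 // => q qp /=.
by rewrite tN ?addNr // -(inj_eq val_inj) gtn_eqF.
Qed.

(* Holding for both square roots of [n], an identity splits into its rational part
   and its part in [sqrt n]. *)
Lemma sqrt_transfer (n : nat) (E E' : nat) (N N' : int) (k : comNzRingType) (s : k) :
  (0 < n)%N -> (E <= 2)%N -> (E' <= 2)%N -> s ^+ 2 = n%:R ->
  (forall r : algC, r ^+ 2 = n%:R -> r ^+ E * N%:~R = r ^+ E' * N'%:~R) ->
  s ^+ E * N%:~R = s ^+ E' * N'%:~R.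
Proof.
move=> n0 lE lE' s2 H.
(* The coordinates of [r ^+ D * m] on 1 and [r], using [r ^+ 2 = n]. Exponents up to 2 suffice for
   the two edges along a side of a face. *)
pose c0 (D : nat) (m : int) : int := if D == 0%N then m else if D == 2 then n%:Z * m else 0.
pose c1 (D : nat) (m : int) : int := if D == 1%N then m else 0.
have dec (A : comNzRingType) (r : A) D m : r ^+ 2 = n%:R -> (D <= 2)%N ->
    r ^+ D * m%:~R = (c0 D m)%:~R + (c1 D m)%:~R * r.
  move=> r2; case: D => [|[|[|//]]] _ /=; rewrite /c0 /c1 /= ?mul0r ?addr0 ?add0r.
  - by rewrite mul1r.
  - by rewrite expr1 mulrC.
  - by rewrite r2 intrM.
have r2 : (sqrtC n%:R : algC) ^+ 2 = n%:R by exact: sqrtCK.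
have r2' : (- sqrtC n%:R : algC) ^+ 2 = n%:R by rewrite sqrrN r2.
have r0 : sqrtC n%:R != 0 :> algC by rewrite sqrtC_eq0 pnatr_eq0 -lt0n.
have := H _ r2; rewrite !dec // => Hp; have := H _ r2'; rewrite !dec // => Hm.
set r := sqrtC _ in Hp Hm r0.
have e0 : (c0 E N)%:~R = (c0 E' N')%:~R :> algC.
  apply: (mulfI (_ : 2%:R != 0)); first by rewrite pnatr_eq0.
  transitivity ((c0 E N)%:~R + (c1 E N)%:~R * r + ((c0 E N)%:~R + (c1 E N)%:~R * - r));
    first by ring.
  by rewrite Hp Hm; ring.
have e1 : (c1 E N)%:~R = (c1 E' N')%:~R :> algC.
  by apply: (mulIf r0); move: Hp; rewrite e0 => /addrI.
move/intr_inj: e0 => e0; move/intr_inj: e1 => e1.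
by rewrite e0 e1.
Qed.

(** * Circles of a state *)

Lemma connect_sub_closed (T : finType) (r : rel T) (x : T) (A : {set T}) :
  x \in A -> (forall y z, y \in A -> r y z -> z \in A) ->
  [set y | connect r x y] \subset A.
Proof.
move=> xA clA; apply/subsetP => y; rewrite inE => /connectP[s].
elim: s x xA => [|z s IH] x xA /=; first by move=> _ ->.
by case/andP=> xz; apply: IH (clA _ _ xA xz).
Qed.

Section Matching.
Local Open Scope nat_scope.
Variables (G : ribbon_graph) (M : {set {set dart G}}) (e : seq {set dart G}).
Hypotheses (htri : trivalent G) (hM : perfect_matching M) (he : enumerates e M).
Local Notation R := (rotation G).
Local Notation opp := (@opposite G).
Local Notation tw := (@twist G).
Local Notation state := (state e).
Implicit Types (x y h : dart G) (a : state) (p : 'I_(size e)).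

Definition matched h : bool := edge h \in e.

Lemma edge_opp h : edge (opp h) = edge h.
Proof. by rewrite /edge oppositeK setUC. Qed.

Lemma matched_opp h : matched (opp h) = matched h.
Proof. by rewrite /matched edge_opp. Qed.

Lemma porbit_card3 x : #|porbit R x| = 3.
Proof. by apply: htri; apply: imset_f. Qed.

Lemma rotation3 x : R (R (R x)) = x.
Proof. by have := iter_porbit R x; rewrite porbit_card3. Qed.

Lemma rotationV x : (R^-1)%g x = R (R x).
Proof. by rewrite -{1}[x]rotation3 permK. Qed.

Lemma rotation_neq x : R x != x.
Proof.
apply/eqP => Rx; have := porbit_card3 x.
suff -> : porbit R x = [set x] by rewrite cards1.
apply/setP => y; rewrite inE; apply/porbitP/eqP => [[i ->]|->].
  by rewrite permX; elim: i => //= i ->.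
by exists 0%N; rewrite perm1.
Qed.

Lemma side_rotation b x : side b x = if b then R x else R (R x).
Proof. by case: b; rewrite /side ?rotationV. Qed.

Lemma side_neq b b' x : (side b x == side b' x) = (b == b').
Proof.
rewrite !side_rotation; case: b; case: b'; rewrite ?eqxx //.
  by apply/negbTE; rewrite eq_sym rotation_neq.
by apply/negbTE; rewrite rotation_neq.
Qed.

Lemma side_porbit b x : side b x \in porbit R x.
Proof.
rewrite side_rotation; case: b; first by rewrite -{1}[R]expg1 mem_porbit.
by rewrite -permM -[(R * R)%g]/(R ^+ 2)%g mem_porbit.
Qed.

Lemma matched_unique h h' : matched h -> matched h' -> h' \in porbit R h -> h' = h.
Proof.
move=> mh mh' hh'; have [_ /(_ (porbit R h))] := hM.
move=> /(_ (imset_f _ isT)) /eqP/cards1P[z zE].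
have [_ eM] := he.
have : h' \in [set z] by rewrite -zE inE hh' -eM.
have : h \in [set z] by rewrite -zE inE porbit_id -eM.
by rewrite !inE => /eqP-> /eqP.
Qed.

Lemma matched_exists x : exists2 h, matched h & h \in porbit R x.
Proof.
have [_ /(_ (porbit R x))] := hM.
move=> /(_ (imset_f _ isT)) /eqP/cards1P[z zE].
have : z \in [set z] by rewrite inE.
by rewrite -zE inE => /andP[zx zM]; exists z => //; have [_ eM] := he; rewrite /matched eM.
Qed.

Lemma side_matched b h : matched h -> ~~ matched (side b h).
Proof.
move=> mh; apply/negP => /(matched_unique mh)/(_ (side_porbit b h)).
apply/eqP; rewrite side_rotation; case: b; first exact: rotation_neq.
by rewrite -{2}[h]rotation3 eq_sym rotation_neq.
Qed.

(* The matched half-edge at the vertex of an unmatched half-edge [x], and its side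
   on which [x] lies; both are meaningless when [x] is matched. *)
Definition stem x : dart G := if matched (R x) then R x else (R^-1)%g x.
Definition stem_side x : bool := ~~ matched (R x).

Lemma stem_sideK x : side (stem_side x) (stem x) = x.
Proof. by rewrite /stem_side /stem /side; case: matched; rewrite ?permK ?permKV. Qed.

Lemma matched_stem x : ~~ matched x -> matched (stem x).
Proof.
move=> nx; have [h mh] := matched_exists x.
rewrite -eq_porbit_mem => /eqP hx.
have : h \in porbit R x by rewrite -hx porbit_id.
rewrite /stem; case: ifP => // nRx /porbitP[i hi].
move: mh; rewrite hi.
have -> : ((R ^+ i)%g x) = ((R ^+ (i %% 3))%g x).
  rewrite {1}(divn_eq i 3) expgD permM mulnC expgM; congr ((R ^+ _)%g _).
  by elim: (i %/ 3)%N => [|j IH]; rewrite ?perm1 // expgSr permM IH permX /= rotation3.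
have: (i %% 3 < 3)%N by rewrite ltn_mod.
case: (i %% 3)%N => [|[|[|//]]] _; rewrite permX /= ?nRx ?(negPf nx) //.
by rewrite rotationV.
Qed.

Lemma stemE b h : matched h -> stem (side b h) = h.
Proof.
move=> mh; apply: (matched_unique mh); first exact: matched_stem (side_matched b mh).
rewrite -eq_porbit_mem.
have /eqP-> : porbit R (stem (side b h)) == porbit R (side b h).
  by rewrite eq_porbit_mem -{2}[side b h]stem_sideK porbit_sym side_porbit.
by rewrite eq_porbit_mem side_porbit.
Qed.

Lemma stem_sideE b h : matched h -> stem_side (side b h) = b.
Proof.
move=> mh; have := stem_sideK (side b h); rewrite stemE // => /eqP.
by rewrite side_neq => /eqP.
Qed.

Lemma mem_medge p h : (h \in medge p) = (edge h == medge p).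
Proof.
have : medge p \in M by case: he => _ <-; apply: mem_tnth.
case: hM => /subsetP sM _ /sM /imsetP[g _ ->].
apply/idP/eqP => [|<-]; last by rewrite !inE eqxx.
by rewrite !inE => /orP[]/eqP->; rewrite ?edge_opp.
Qed.

Lemma medge_matched p h : h \in medge p -> matched h.
Proof. by rewrite mem_medge /matched => /eqP->; apply: mem_tnth. Qed.

Lemma matched_medge h : matched h -> exists p, h \in medge p.
Proof.
by move=> /(tnthP (in_tuple e))[p hp]; exists p; rewrite mem_medge hp.
Qed.

Lemma medge_inj p p' h : h \in medge p -> h \in medge p' -> p = p'.
Proof.
rewrite !mem_medge => /eqP -> /eqP pp'; apply: val_inj => /=.
have [ue _] := he; have x0 : {set dart G} := set0.
apply/eqP; rewrite -(nth_uniq x0 _ _ ue) //; apply/eqP.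
by move: pp'; rewrite /medge !(tnth_nth x0).
Qed.

Lemma medge_opp p h : (opp h \in medge p) = (h \in medge p).
Proof. by rewrite !mem_medge edge_opp. Qed.

Definition smoothing a h : bool := [exists p, (h \in medge p) && a p].

Lemma smoothingE a p h : h \in medge p -> smoothing a h = a p.
Proof.
move=> hp; apply/existsP/idP => [[q /andP[hq aq]]|ap]; last by exists p; rewrite hp.
by rewrite (medge_inj hp hq).
Qed.

Lemma smoothing_opp a h : smoothing a (opp h) = smoothing a h.
Proof. by apply: eq_existsb => p; rewrite medge_opp. Qed.

(** The relation [joined a] as a function. On unmatched half-edges [partner a] and [opposite] are
    fixed-point-free involutions, and a circle is an orbit of the two together. *)
Definition partner a x : dart G :=
  side (~~ stem_side x (+) tw (stem x) (+) smoothing a (stem x)) (opp (stem x)).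

Lemma partner_side a b h : matched h ->
  partner a (side b h) = side (~~ b (+) tw h (+) smoothing a h) (opp h).
Proof. by move=> mh; rewrite /partner stemE // stem_sideE. Qed.

Lemma partner_unmatched a x : ~~ matched x -> ~~ matched (partner a x).
Proof. by move=> nx; apply: side_matched; rewrite matched_opp matched_stem. Qed.

Lemma stem_partner a x : ~~ matched x -> stem (partner a x) = opp (stem x).
Proof. by move=> nx; rewrite stemE // matched_opp matched_stem. Qed.

Lemma partnerK a x : ~~ matched x -> partner a (partner a x) = x.
Proof.
move=> nx; have mx := matched_stem nx.
rewrite {2}/partner partner_side ?matched_opp // oppositeK twist_opposite smoothing_opp.
rewrite -[RHS]stem_sideK; congr side.
by case: stem_side; case: tw; case: smoothing.
Qed.

Lemma partner_neq a x : ~~ matched x -> partner a x != x.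
Proof.
move=> nx; apply: contraNneq (opposite_neq (stem x)) => px.
by rewrite -(stem_partner a nx) px.
Qed.

Lemma joinedE a x y : joined a x y = ~~ matched x && (y == partner a x).
Proof.
apply/existsP/andP => [[p /existsP[h /andP[hp /existsP[b /andP[/eqP-> /eqP->]]]]]|[nx /eqP->]].
  have mh := medge_matched hp.
  by rewrite side_matched // partner_side // (smoothingE a hp).
have [p xp] := matched_medge (matched_stem nx).
exists p; apply/existsP; exists (stem x); rewrite xp /=.
by apply/existsP; exists (stem_side x); rewrite stem_sideK /partner (smoothingE a xp) !eqxx.
Qed.

Lemma linkedE a x y :
  linked a x y = (y == opp x) || ~~ matched x && (y == partner a x).
Proof. by rewrite /linked joinedE. Qed.

Lemma linked_sym a : symmetric (linked a).
Proof.
suff sub x y : linked a x y -> linked a y x.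
  by move=> x y; apply/idP/idP; apply: sub.
rewrite !linkedE => /orP[/eqP->|/andP[nx /eqP->]]; first by rewrite oppositeK eqxx.
by rewrite partner_unmatched // partnerK // eqxx orbT.
Qed.

Lemma linked_matched a x y : linked a x y -> matched y = matched x.
Proof.
rewrite linkedE => /orP[/eqP->|/andP[nx /eqP->]]; first exact: matched_opp.
by rewrite (negPf nx) (negPf (partner_unmatched a nx)).
Qed.

Definition component a x : {set dart G} := [set y | connect (linked a) x y].

Lemma component_id a x : x \in component a x.
Proof. by rewrite inE connect0. Qed.

Lemma component_eq a x y : y \in component a x -> component a y = component a x.
Proof.
rewrite inE => xy; apply/setP => z.
by rewrite !inE (same_connect (sym_connect_sym (linked_sym a)) xy).
Qed.

Lemma component_ind a x (A : {set dart G}) : x \in A ->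
  (forall y z, y \in A -> linked a y z -> z \in A) -> component a x \subset A.
Proof. exact: connect_sub_closed. Qed.

Lemma component_linked a x y z : y \in component a x -> linked a y z -> z \in component a x.
Proof. by rewrite !inE => xy yz; apply: connect_trans xy (connect1 yz). Qed.

Lemma component_opp a x y : (opp y \in component a x) = (y \in component a x).
Proof.
have step u : u \in component a x -> opp u \in component a x.
  by move=> xu; apply: component_linked xu _; rewrite linkedE eqxx.
by apply/idP/idP; [rewrite -{2}[y]oppositeK|]; apply: step.
Qed.

Lemma component_partner a x y : ~~ matched y ->
  (partner a y \in component a x) = (y \in component a x).
Proof.
have step u : ~~ matched u -> u \in component a x -> partner a u \in component a x.
  by move=> nu xu; apply: component_linked xu _; rewrite linkedE nu eqxx orbT.
move=> ny; apply/idP/idP; last exact: step.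
by rewrite -{2}[y](partnerK a) //; apply: step; apply: partner_unmatched.
Qed.

Lemma component_unmatched a x y : y \in component a x -> matched y = matched x.
Proof.
have /subsetP : component a x \subset [set y | matched y == matched x].
  apply: component_ind => [|u v]; rewrite !inE // => /eqP <- /linked_matched->.
  by [].
by move=> sub /sub; rewrite inE => /eqP.
Qed.

Lemma component_stable a b x :
  (forall y z, y \in component a x -> linked a y z = linked b y z) ->
  component b x = component a x.
Proof.
move=> ab; have /subsetP sub : component b x \subset component a x.
  apply: component_ind => [|y z ya yz]; first exact: component_id.
  by apply: component_linked (ya) _; rewrite (ab _ _ ya).
apply/eqP; rewrite eqEsubset; apply/andP; split; first exact/subsetP.
apply: component_ind => [|y z yb yz]; first exact: component_id.
by apply: component_linked (yb) _; rewrite -(ab _ _ (sub _ yb)).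
Qed.

Lemma circlesP a c :
  reflect (exists2 x, ~~ matched x & c = component a x) (c \in circles a).
Proof. by apply: (iffP imsetP) => -[x nx ->]; exists x; rewrite ?inE // in nx *. Qed.

Lemma circle_component a c x : c \in circles a -> x \in c ->
  ~~ matched x /\ c = component a x.
Proof.
case/circlesP => y ny -> yx; split; last by rewrite (component_eq yx).
by rewrite (component_unmatched yx).
Qed.

Lemma component_circle a x : ~~ matched x -> component a x \in circles a.
Proof. by move=> nx; apply/circlesP; exists x. Qed.

Definition at_edge p x := ~~ matched x && (stem x \in medge p).

Lemma touchesP p (c : {set dart G}) :
  reflect (exists2 x, at_edge p x & x \in c) (touches p c).
Proof.
apply: (iffP existsP) => [[h /andP[hp /existsP[b hc]]]|[x /andP[nx xp] xc]].
  exists (side b h) => //; have mh := medge_matched hp.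
  by rewrite /at_edge side_matched // stemE.
by exists (stem x); rewrite xp; apply/existsP; exists (stem_side x); rewrite stem_sideK.
Qed.

(** For an unmatched [x], the other unmatched half-edge at its vertex. Flipping the matched edge
    there exchanges the partners of [x] and [sibling x]. *)
Definition sibling x : dart G := side (~~ stem_side x) (stem x).

Lemma sibling_unmatched x : ~~ matched x -> ~~ matched (sibling x).
Proof. by move=> nx; apply: side_matched; apply: matched_stem. Qed.

Lemma stem_sibling x : ~~ matched x -> stem (sibling x) = stem x.
Proof. by move=> nx; rewrite stemE // matched_stem. Qed.

Lemma siblingK x : ~~ matched x -> sibling (sibling x) = x.
Proof.
move=> nx; rewrite /sibling stemE ?stem_sideE ?matched_stem //.
by rewrite negbK stem_sideK.
Qed.

Lemma at_edge_sibling p x : at_edge p x -> at_edge p (sibling x).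
Proof. by case/andP=> nx xp; rewrite /at_edge sibling_unmatched // stem_sibling. Qed.

Lemma at_edge_partner a p x : at_edge p x -> at_edge p (partner a x).
Proof.
by case/andP=> nx xp; rewrite /at_edge partner_unmatched // stem_partner // medge_opp.
Qed.

Lemma at_edge4 a p x y : at_edge p x -> at_edge p y ->
  [\/ y = x, y = sibling x, y = partner a x | y = partner a (sibling x)].
Proof.
case/andP=> nx xp /andP[ny yp].
have [sy|sy] : stem y = stem x \/ stem y = opp (stem x).
  move: yp; rewrite mem_medge => /eqP ye; move: xp; rewrite mem_medge -ye => /eqP xye.
  have : stem y \in edge (stem x) by rewrite xye !inE eqxx.
  by rewrite !inE => /orP[]/eqP; [left|right].
- have [sb|sb] := eqVneq (stem_side y) (stem_side x).
    by constructor 1; rewrite -(stem_sideK y) sy sb stem_sideK.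
  constructor 2; rewrite -(stem_sideK y) sy /sibling; congr side.
  by move: sb; case: stem_side; case: stem_side.
- have mx := matched_stem nx.
  rewrite -(stem_sideK y) sy /partner stem_sibling // [stem_side (sibling x)]stem_sideE //.
  by case: (stem_side y); case: (stem_side x); case: tw; case: smoothing;
    first [by constructor 3 | by constructor 4].
Qed.

Definition flipped p a : state := [ffun q => (q == p) || a q].

Section Flip.
Variables (p : 'I_(size e)) (a : state).
Hypothesis ap : ~~ a p.
Local Notation a' := (flipped p a).

Lemma partner_flip_away x : ~~ matched x -> ~~ at_edge p x -> partner a' x = partner a x.
Proof.
move=> nx; rewrite /at_edge nx /= => xp; rewrite /partner; congr (side (_ (+) _) _).
have [q xq] := matched_medge (matched_stem nx).
rewrite !(smoothingE _ xq) ffunE; case: eqP => // qp.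
by rewrite -qp xq in xp.
Qed.

Lemma partner_flip x : at_edge p x -> partner a' x = partner a (sibling x).
Proof.
case/andP=> nx xp; rewrite /partner stem_sibling // !(smoothingE _ xp) ffunE eqxx.
rewrite /sibling stem_sideE ?matched_stem // (negPf ap) orTb.
by congr side; case: stem_side; case: tw.
Qed.

Lemma partner_flip_sibling x : at_edge p x -> partner a' (sibling x) = partner a x.
Proof.
move=> xp; rewrite partner_flip ?at_edge_sibling // siblingK //.
by case/andP: xp.
Qed.

Lemma untouched_linked c y z : ~~ touches p c -> y \in c -> linked a' y z = linked a y z.
Proof.
move=> tc yc; rewrite !linkedE; case ny: (matched y) => //=.
by rewrite partner_flip_away ?ny //; apply: contra tc => yp; apply/touchesP; exists y.
Qed.

Lemma untouched_circle c : ~~ touches p c -> (c \in circles a') = (c \in circles a).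
Proof.
move=> tc.
have ll y z : y \in c -> linked a' y z = linked a y z by apply: untouched_linked.
apply/circlesP/circlesP => -[x nx cx]; exists x => //; rewrite cx.
  by apply/esym/component_stable => y z; rewrite -cx => /ll.
by apply/esym/component_stable => y z; rewrite -cx => /ll.
Qed.

(* Joining by all links except those at [p] cuts each component into pieces in
   which the opposite involution and, away from [p], the partner involution act
   freely: so every piece meets [p] in an even number of half-edges. *)
Lemma resmoothed_connected x : at_edge p x ->
  sibling x \notin component a x -> sibling x \in component a' x.
Proof.
move=> xp sx; apply/negPn/negP => sx'.
pose l y z := (z == opp y) || [&& ~~ matched y, ~~ at_edge p y & z == partner a y].
have lsym : symmetric l.
  suff sub y z : l y z -> l z y by move=> y z; apply/idP/idP; apply: sub.
  rewrite /l => /orP[/eqP->|/and3P[ny yp /eqP->]]; first by rewrite oppositeK eqxx.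
  rewrite partner_unmatched // partnerK // eqxx andbT; apply/orP; right.
  by apply: contra yp => /(at_edge_partner a); rewrite partnerK.
pose E := [set y | connect l x y].
have xE : x \in E by rewrite inE connect0.
have Ecl y z : y \in E -> l y z -> z \in E.
  by rewrite !inE => xy yz; apply: connect_trans xy (connect1 yz).
have /subsetP sa : E \subset component a x.
  apply: connect_sub_closed => [|y z ya]; first exact: component_id.
  by case/orP=> [/eqP->|/and3P[ny _ /eqP->]]; rewrite ?component_opp ?component_partner.
have /subsetP sa' : E \subset component a' x.
  apply: connect_sub_closed => [|y z ya]; first exact: component_id.
  case/orP=> [/eqP->|/and3P[ny yp /eqP->]]; rewrite ?component_opp //.
  by rewrite -partner_flip_away // component_partner.
have nx : ~~ matched x by case/andP: xp.
have nE y : y \in E -> ~~ matched y by move=> /sa /component_unmatched->.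
have evE : ~~ odd #|E|.
  apply: (@even_fixfree_involution _ opp) => y yE; split; last exact: oppositeK.
    by apply: Ecl yE _; rewrite /l eqxx.
  exact: opposite_neq.
have evE' : ~~ odd #|E :\: [set y | at_edge p y]|.
  apply: (@even_fixfree_involution _ (partner a)) => y; rewrite !inE => /andP[yp yE].
  have ny : ~~ matched y by apply: nE; rewrite inE.
  split; [apply/andP; split|exact: partner_neq|exact: partnerK].
    by apply: contra yp => /(at_edge_partner a); rewrite partnerK.
  have := @Ecl y (partner a y); rewrite !inE; apply => //.
  by rewrite /l ny yp eqxx orbT.
(* Of the four half-edges at [p], [sibling x] and its partner before the flip are cut off from [x]
   in [a]; the partner of [x] before the flip is the partner of [sibling x] after it, so it is cut
   off in the flipped state. [E] lies in both components of [x]. *)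
have E1 : E :&: [set y | at_edge p y] = [set x].
  apply/setP => y; rewrite !inE -/E; apply/andP/eqP => [[]|->]; last by rewrite connect0.
  move=> xy yp; have yE : y \in E by rewrite inE.
  case: (at_edge4 a xp yp) => // yE'.
  - by move: (sa _ yE); rewrite yE' (negPf sx).
  - move: (sa' _ yE); rewrite yE' -partner_flip_sibling //.
    by rewrite component_partner ?sibling_unmatched // (negPf sx').
  - move: (sa _ yE); rewrite yE' component_partner ?sibling_unmatched //.
    by rewrite (negPf sx).
by move: evE; rewrite -(cardsID [set y | at_edge p y]) E1 cards1 /= (negPf evE').
Qed.

End Flip.

Lemma at_edge_exists p : exists x, at_edge p x.
Proof.
have : medge p \in M by case: he => _ <-; apply: mem_tnth.
case: hM => /subsetP sM _ /sM /imsetP[h _ ph].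
have hp : h \in medge p by rewrite ph !inE eqxx.
by exists (side true h); rewrite /at_edge side_matched ?stemE ?(medge_matched hp).
Qed.

(** The half-edges at the far end of [p] are the partners of [x] and [sibling x], so they bring no
    further circle. *)
Lemma touched_circle a p x c : at_edge p x -> (c \in circles a) && touches p c =
  (c \in [set component a x; component a (sibling x)]).
Proof.
move=> xp; have nx : ~~ matched x by case/andP: xp.
rewrite !inE; apply/andP/orP => [[cc /touchesP[y yp yc]]|].
  have [_ ->] := circle_component cc yc.
  case: (at_edge4 a xp yp) => ->; [left|right|left|right] => //.
    by apply/eqP/component_eq; rewrite component_partner // component_id.
  by apply/eqP/component_eq; rewrite component_partner ?sibling_unmatched // component_id.
case=> /eqP->; rewrite component_circle ?sibling_unmatched //; split=> //; apply/touchesP.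
  by exists x; rewrite ?component_id.
by exists (sibling x); rewrite ?component_id ?at_edge_sibling.
Qed.


Local Open Scope ring_scope.
Implicit Types (b : state).

Lemma affected_mem p b (c : circle b) : (c \in affected p b) = touches p (val c).
Proof. by rewrite mem_filter mem_enum andbT. Qed.

Lemma affected_uniq p b : uniq (affected p b).
Proof. by rewrite filter_uniq // enum_uniq. Qed.

Lemma affected_size p b x : at_edge p x ->
  size (affected p b) = (sibling x \notin component b x).+1.
Proof.
move=> xp; have nx : ~~ matched x by case/andP: xp.
rewrite -(card_uniqP (affected_uniq p b)) -(card_imset _ val_inj).
have -> : [set val c | c in affected p b] = [set component b x; component b (sibling x)].
  apply/setP => s; rewrite -(touched_circle b s xp); apply/imsetP/andP => [[c]|[sb ts]].
    by rewrite affected_mem => tc ->; split=> //; exact: (valP c).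
  by exists (exist _ s sb) => //; rewrite affected_mem.
rewrite cards2; congr (nat_of_bool _).+1; congr (~~ _).
apply/eqP/idP => [->|]; first exact: component_id.
by move=> sx; rewrite (component_eq sx).
Qed.

(** The numbers of affected circles are read off from whether [x] and [sibling x] are separated;
    [resmoothed_connected] rules out separation in both states. *)
Lemma affectedP p a b x : ~~ a p -> b = flipped p a -> at_edge p x ->
  flip_shape (affected p a) (affected p b)
    (sibling x \in component a x) (sibling x \in component b x).
Proof.
move=> ap -> xp; have := affected_size a xp; have := affected_size (flipped p a) xp.
have := affected_uniq p a; have := affected_uniq p (flipped p a).
have := resmoothed_connected ap xp.
case: (sibling x \in component a x); case: (sibling x \in component _ x) => //= H;
  case: (affected p a) => [|c [|c1 [|? ?]]] //;
    case: (affected p _) => [|c' [|c1' [|? ?]]] //=;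
  rewrite ?inE ?andbT => *; try by constructor.
by have := H isT.
Qed.

Lemma affected_component p b x (c : circle b) : at_edge p x -> c \in affected p b ->
  val c = component b x \/ val c = component b (sibling x).
Proof.
move=> xp; rewrite affected_mem => tc.
have := touched_circle b (val c) xp; rewrite (valP c) tc => /esym.
by rewrite !inE => /orP[]/eqP; [left|right].
Qed.

Lemma affected_pair p b x (c1 c2 : circle b) : at_edge p x -> affected p b = [:: c1; c2] ->
  (val c1 = component b x /\ val c2 = component b (sibling x)) \/
  (val c1 = component b (sibling x) /\ val c2 = component b x).
Proof.
move=> xp E; have := affected_uniq p b; rewrite E /= inE andbT -(inj_eq val_inj).
have c1p : c1 \in affected p b by rewrite E inE eqxx.
have c2p : c2 \in affected p b by rewrite E !inE eqxx orbT.
case: (affected_component xp c1p) (affected_component xp c2p) => /= -> [] /= ->;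
  rewrite ?eqxx //; auto.
Qed.

(** * Colourings of the half-edges *)

Section Colourings.
Variable I : eqType.

(** Such a [g] descends to the circles of [b]. Living on half-edges, it can also be tested in the
    neighbouring states, whose circles differ. *)
Definition compatible b (g : dart G -> I) :=
  [forall x, forall y, linked b x y ==> (g x == g y)].

Lemma compatible_component b g x y :
  compatible b g -> y \in component b x -> g y = g x.
Proof.
move=> /forallP cg; have /subsetP : component b x \subset [set y | g y == g x].
  apply: component_ind => [|u v]; rewrite !inE // => /eqP <- uv.
  by have /forallP/(_ v)/implyP/(_ uv)/eqP-> := cg u.
by move=> /(_ y) H /H; rewrite inE => /eqP.
Qed.

(** The links of [b] at [p] join [x] to the old partner of [sibling x] and conversely, so [g] takes
    at most two values around [p]. Each link of [a] at [p] joins half-edges carrying these two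
    values. *)
Lemma compatible_flipped p a b g x : ~~ a p -> b = flipped p a -> at_edge p x ->
  compatible b g -> compatible a g = (g x == g (sibling x)).
Proof.
move=> ap -> xp cg; have nx : ~~ matched x by case/andP: xp.
have gp b' y : compatible b' g -> ~~ matched y -> g (partner b' y) = g y.
  move=> cb ny; apply: (compatible_component cb).
  by rewrite component_partner ?component_id.
have gs := gp _ _ cg (sibling_unmatched nx); rewrite partner_flip_sibling // in gs.
have gx := gp _ _ cg nx; rewrite partner_flip // in gx.
apply/idP/eqP => [ca|gxs]; first by rewrite -gs gp.
have g4 y : at_edge p y -> g y = g x.
  by move=> yp; case: (at_edge4 a xp yp) => ->; rewrite ?gs ?gx.
apply/forallP => y; apply/forallP => z; apply/implyP.
have [yp|yp] := boolP (at_edge p y).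
  have ny : ~~ matched y by case/andP: yp.
  rewrite linkedE ny /= => /orP[/eqP->|/eqP->].
    by have /forallP/(_ y)/forallP/(_ (opp y))/implyP := cg; apply; rewrite linkedE eqxx.
  by rewrite !g4 // at_edge_partner.
move=> yz; have /forallP/(_ y)/forallP/(_ z)/implyP := cg; apply.
move: yz; rewrite !linkedE; case ny: (matched y) => //=.
by rewrite partner_flip_away ?ny.
Qed.

(** The colour of an arbitrary element: meaningful when [g] is constant on [s], and [d] on the empty
    set. *)
Definition colour (d : I) (g : dart G -> I) (s : {set dart G}) : I :=
  if [pick y in s] is Some y then g y else d.

Lemma colour_component d b g x : compatible b g -> colour d g (component b x) = g x.
Proof.
move=> cg; rewrite /colour; case: pickP => [y yx|/(_ x)].
  exact: compatible_component cg yx.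
by rewrite component_id.
Qed.

End Colourings.

(** * Commutation of the faces of the cube *)

Definition gen n b (f : {ffun circle b -> 'I_n}) : generator n e :=
  Tagged (fun s : state => {ffun circle s -> 'I_n}) f.

Definition edge_with n (A : pzSemiRingType) (mu de : 'I_n -> 'I_n -> 'I_n -> A)
    (et : 'I_n -> 'I_n -> A) p (u v : generator n e) : A :=
  (same_outside p u v)%:R * local_edge mu de et (affected p (gen_state u))
    (affected p (gen_state v)) (gen_label u) (gen_label v).

(** The circles away from [p] are the same sets in both states but inhabit different types; hence
    [F] is a function of sets of half-edges. *)
Lemma big_untouched (A : Type) (idx : A) (op : Monoid.com_law idx) p a b
    (F : {set dart G} -> A) : b = flipped p a ->
  \big[op/idx]_(c : circle a | c \notin affected p a) F (val c) =
  \big[op/idx]_(c : circle b | c \notin affected p b) F (val c).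
Proof.
have big_circles b' : \big[op/idx]_(c : circle b' | c \notin affected p b') F (val c) =
    \big[op/idx]_(s in circles b' | ~~ touches p s) F s.
  transitivity (\big[op/idx]_(c : circle b' | ~~ touches p (val c)) F (val c)).
    by apply: eq_bigl => c; rewrite affected_mem.
  exact/esym/(@big_sub_cond _ _ op _ (mem (circles b')) (fun s => ~~ touches p s)).
move=> ->; transitivity (\big[op/idx]_(s in circles a | ~~ touches p s) F s).
  exact: big_circles.
transitivity (\big[op/idx]_(s in circles (flipped p a) | ~~ touches p s) F s); last first.
  exact/esym/big_circles.
apply: eq_bigl => s; have [ts|ts] := boolP (touches p s); first by rewrite !andbF.
by rewrite (untouched_circle a ts).
Qed.

Section Labels.
Variable I : eqType.

(** A labelling made independent of the type of circles of its state, so that it can be read in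
    another state. *)
Definition extended (d : I) b (f : circle b -> I) (s : {set dart G}) : I :=
  if insub s is Some c then f c else d.

Lemma extended_val d b (f : circle b -> I) c : extended d f (val c) = f c.
Proof. by rewrite /extended valK. Qed.

End Labels.

Lemma same_outsideE n (d : 'I_n) p a b (f : {ffun circle a -> 'I_n}) (f' : {ffun circle b ->
  'I_n}) :
  b = flipped p a ->
  same_outside p (gen f)
                 (gen f') =
  [forall c, (c \notin affected p b) ==> (f' c == [ffun c => extended d f (val c)] c)].
Proof.
move=> ab; apply/forallP/forallP => /= [H c'|H c].
  rewrite affected_mem ffunE; apply/implyP => tc.
  have c'a : val c' \in circles a by rewrite -(untouched_circle a tc) -ab; exact: valP.
  have /forallP/(_ c') := H (exist _ (val c') c'a).
  rewrite eqxx tc /= /gen_label /= => /eqP <-.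
  by apply/eqP/esym; apply: (extended_val d f (exist _ (val c') c'a)).
apply/forallP => c'; apply/implyP => /andP[/eqP cc' tc].
have ec : extended d f (sval c') = f c by rewrite -cc'; exact: extended_val.
have := H c'; rewrite [c' \in _]affected_mem [in X in _ == X]ffunE /= ec -cc' tc.
by rewrite /gen_label /= eq_sym.
Qed.

Section ColourBasis.
Variables (A : comNzRingType) (n : nat).
Variables (mu de : 'I_n -> 'I_n -> 'I_n -> A) (et : 'I_n -> 'I_n -> A).
Variables (y theta : 'I_n -> A) (d : 'I_n).
Hypothesis mu_y : forall i j g, \sum_l mu i j l * y g ^+ l = y g ^+ i * y g ^+ j.
Hypothesis et_y : forall i g, \sum_l et i l * y g ^+ l = theta g * y g ^+ i.
Hypothesis de_y : forall l g g', \sum_i \sum_j de l i j * (y g ^+ i * y g' ^+ j) =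
  (g == g')%:R * theta g ^+ 2 * y g ^+ l.
Local Notation coloured_edge := (edge_with mu de et).

(** The pure tensor of monomials [f], seen as a function on tuples of points and evaluated at the
    tuple selected by [g]. *)
Definition evaluate b (f : {ffun circle b -> 'I_n}) (g : dart G -> 'I_n) : A :=
  \prod_c y (colour d g (val c)) ^+ f c.

Definition circle_weight b (g : dart G -> 'I_n) : A :=
  \prod_(c : circle b) theta (colour d g (val c)).

Definition flip_factor a b x (g : dart G -> 'I_n) : A :=
  local_factor theta (sibling x \in component a x) (sibling x \in component b x) (g x).

Section Flip.
Variables (p : 'I_(size e)) (a b : state) (x : dart G) (g : dart G -> 'I_n).
Hypotheses (ap : ~~ a p) (ab : b = flipped p a) (xp : at_edge p x).
Hypothesis cg : compatible b g.

Let colour_after : if sibling x \in component b x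
  then (g x == g (sibling x)) &&
    all (fun c : circle b => colour d g (val c) == g x) (affected p b)
  else perm_eq [seq colour d g (val c) | c <- affected p b] [:: g x; g (sibling x)].
Proof.
case: ifP => sx.
  have gx : g (sibling x) = g x := compatible_component cg sx.
  rewrite gx eqxx; apply/allP => c /(affected_component xp)[] ->;
  by rewrite (colour_component _ _ cg) ?gx.
have := affected_size b xp; rewrite sx.
case E: (affected p b) => [|c1 [|c2 [|? ?]]] //= _.
case: (affected_pair xp E) => -[/= -> ->]; rewrite !(colour_component _ _ cg) //.
by rewrite (perm_catC [:: _] [:: _]).
Qed.

Let colour_before : g x = g (sibling x) ->
  all (fun c : circle a => colour d g (val c) == g x) (affected p a).
Proof.
move=> gx; have ca : compatible a g by rewrite (compatible_flipped ap ab xp cg) gx eqxx.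
by apply/allP => c /(affected_component xp)[] ->; rewrite (colour_component _ _ ca) ?gx.
Qed.

(** Compatibility is assumed only after the flip. If it fails before, the colours of [x] and
    [sibling x] differ and both sides are zero, so the arbitrary choice inside [colour] does no
    harm. *)
Lemma edge_with_evaluate (f : {ffun circle a -> 'I_n}) :
  \sum_(f' : {ffun circle b -> 'I_n}) coloured_edge p (gen f) (gen f') * evaluate f' g =
  (g x == g (sibling x))%:R * flip_factor a b x g * evaluate f g.
Proof.
rewrite /evaluate /flip_factor.
rewrite -(local_edge_colour mu_y et_y de_y (affectedP ap ab xp) colour_after colour_before
  (f0 := [ffun c => extended d f (val c)])).
  by apply: eq_bigr => f' _; rewrite /edge_with (same_outsideE d f f' ab).
transitivity (\prod_(c : circle a | c \notin affected p a)
    y (colour d g (val c)) ^+ extended d f (val c)).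
  by apply: eq_bigr => c _; rewrite extended_val.
transitivity (\prod_(c : circle b | c \notin affected p b)
    y (colour d g (val c)) ^+ extended d f (val c)).
  exact: (big_untouched _ (fun s => y (colour d g s) ^+ extended d f s) ab).
by apply: eq_bigr => c _; rewrite ffunE.
Qed.

Lemma flip_factor_weight : g x = g (sibling x) ->
  flip_factor a b x g * circle_weight a g = theta (g x) * circle_weight b g.
Proof.
move=> gx; apply: (local_factor_weight (affectedP ap ab xp) colour_after colour_before gx).
exact: (big_untouched _ (fun s => theta (colour d g s)) ab).
Qed.

End Flip.

End ColourBasis.

Section Faces.
Variables (A : comNzRingType) (n : nat).
Variables (mu de : 'I_n -> 'I_n -> 'I_n -> A) (et : 'I_n -> 'I_n -> A).
Local Notation coloured_edge := (edge_with mu de et).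

Definition face p q a b c (f : {ffun circle a -> 'I_n}) (f'' : {ffun circle c -> 'I_n}) : A :=
  \sum_(f' : {ffun circle b -> 'I_n})
    coloured_edge p (gen f) (gen f') * coloured_edge q (gen f') (gen f'').

Variables (y theta : 'I_n -> A) (d : 'I_n).
Hypothesis mu_y : forall i j g, \sum_l mu i j l * y g ^+ l = y g ^+ i * y g ^+ j.
Hypothesis et_y : forall i g, \sum_l et i l * y g ^+ l = theta g * y g ^+ i.
Hypothesis de_y : forall l g g', \sum_i \sum_j de l i j * (y g ^+ i * y g' ^+ j) =
  (g == g')%:R * theta g ^+ 2 * y g ^+ l.

(* The factors of the two edge maps telescope: the right-hand side is symmetric
   in [p] and [q]. *)
Lemma face_evaluate p q a b c x z (f : {ffun circle a -> 'I_n}) g :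
  ~~ a p -> b = flipped p a -> at_edge p x ->
  ~~ b q -> c = flipped q b -> at_edge q z -> compatible c g ->
  circle_weight theta d a g *
    \sum_(f'' : {ffun circle c -> 'I_n}) face p q b f f'' * evaluate y d f'' g =
  (g x == g (sibling x))%:R * (g z == g (sibling z))%:R * (theta (g x) * theta (g z)) *
  circle_weight theta d c g * evaluate y d f g.
Proof.
move=> ap ab xp bq bc zq cg.
have -> : \sum_(f'' : {ffun circle c -> 'I_n}) face p q b f f'' * evaluate y d f'' g =
    \sum_(f' : {ffun circle b -> 'I_n}) coloured_edge p (gen f) (gen f') *
      ((g z == g (sibling z))%:R * flip_factor theta b c z g * evaluate y d f' g).
  transitivity (\sum_(f' : {ffun circle b -> 'I_n}) \sum_(f'' : {ffun circle c -> 'I_n})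
      coloured_edge p (gen f) (gen f') * (coloured_edge q (gen f') (gen f'') * evaluate y d
        f'' g)).
    rewrite exchange_big; apply: eq_bigr => f'' _; rewrite /face mulr_suml.
    by apply: eq_bigr => f' _; rewrite mulrA.
  apply: eq_bigr => f' _; rewrite -mulr_sumr; congr (_ * _).
  exact: (edge_with_evaluate d mu_y et_y de_y bq bc zq cg).
have cbg := compatible_flipped bq bc zq cg.
(* Compatibility descends from [c] to [b] exactly when the colours at [z] agree; otherwise both
   sides vanish. The second flip is therefore treated before the first. *)
move: cbg; case: eqP => [gz|_] cbg; last first.
  by rewrite big1 ?mulr0 ?mul0r // => f' _; rewrite !mul0r mulr0.
transitivity (circle_weight theta d a g * (flip_factor theta b c z g *
    \sum_(f' : {ffun circle b -> 'I_n}) coloured_edge p (gen f) (gen f') * evaluate y d f' g)).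
  by congr (_ * _); rewrite mulr_sumr; apply: eq_bigr => f' _; rewrite mul1r mulrCA.
rewrite (edge_with_evaluate d mu_y et_y de_y ap ab xp cbg) mulr1.
case: eqP => [gx|_]; last by rewrite !mul0r !mulr0.
have wx := flip_factor_weight theta d ap ab xp cbg gx.
have wz := flip_factor_weight theta d bq bc zq cg gz.
rewrite !mul1r mulrCA !mulrA -(mulrA (flip_factor _ _ _ _ _)) [circle_weight _ _ _ _ * _]mulrC.
rewrite wx; congr (_ * _).
by rewrite mulrCA mulrA -mulrA wz mulrA.
Qed.

End Faces.

Section FaceCommutation.
Variables (A : idomainType) (n : nat).
Variables (mu de : 'I_n -> 'I_n -> 'I_n -> A) (et : 'I_n -> 'I_n -> A).
Variables (y theta : 'I_n -> A) (dual : 'I_n -> 'I_n -> A) (kap : 'I_n -> A).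
Hypothesis mu_y : forall i j g, \sum_l mu i j l * y g ^+ l = y g ^+ i * y g ^+ j.
Hypothesis et_y : forall i g, \sum_l et i l * y g ^+ l = theta g * y g ^+ i.
Hypothesis de_y : forall l g g', \sum_i \sum_j de l i j * (y g ^+ i * y g' ^+ j) =
  (g == g')%:R * theta g ^+ 2 * y g ^+ l.
Hypothesis dual_y : forall i l : 'I_n, \sum_j dual j l * y j ^+ i = (i == l)%:R * kap l.
Hypothesis kap_neq0 : forall l, kap l != 0.
Hypothesis theta_neq0 : forall g, theta g != 0.
Hypothesis n_gt0 : (0 < n)%N.

(** As a function of [f''], the difference of the two sides is tested against all colourings of the
    circles of [c], which separate functions of [f''] by [ffun_grid_inj]. *)
Lemma face_commute p q a b b' c (f : {ffun circle a -> 'I_n}) (f'' : {ffun circle c -> 'I_n}) :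
  ~~ a p -> ~~ a q -> p != q -> b = flipped p a -> b' = flipped q a ->
  c = flipped q b -> c = flipped p b' ->
  face mu de et p q b f f'' = face mu de et q p b' f f''.
Proof.
move=> ap aq pq ab ab' bc bc'.
have bq : ~~ b q by rewrite ab ffunE negb_or eq_sym pq.
have bp : ~~ b' p by rewrite ab' ffunE negb_or pq.
have [x xp] := at_edge_exists p; have [z zq] := at_edge_exists q.
pose d : 'I_n := Ordinal n_gt0.
apply/eqP; rewrite -subr_eq0; apply/eqP; move: f''.
apply: (ffun_grid_inj dual_y kap_neq0) => col.
(* The colouring of circles lifted to half-edges; matched half-edges lie on no circle and get the
   default [d]. *)
pose g (t : dart G) : 'I_n := extended d col (component c t).
have cg : compatible c g.
  apply/forallP => t; apply/forallP => u; apply/implyP => tu.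
  by rewrite /g (component_eq (component_linked (component_id c t) tu)).
have evE (h : {ffun circle c -> 'I_n}) : \prod_w y (col w) ^+ h w = evaluate y d h g.
  apply: eq_bigr => w _; congr (y _ ^+ _).
  have [t nt wt] := circlesP _ _ (valP w).
  have -> : colour d g (val w) = g t by rewrite wt (colour_component _ _ cg).
  by rewrite /g -wt extended_val.
under eq_bigr do rewrite evE mulrBl.
rewrite sumrB; apply/eqP; rewrite subr_eq0; apply/eqP.
(* [face_evaluate] controls the sum only after multiplication by this weight, which is cancelled in
   the domain [A]. *)
have w0 : circle_weight theta d a g != 0 by apply/prodf_neq0.
apply: (mulfI w0).
rewrite (face_evaluate d mu_y et_y de_y f ap ab xp bq bc zq cg).
rewrite (face_evaluate d mu_y et_y de_y f aq ab' zq bp bc' xp cg).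
by rewrite [in RHS](mulrC (theta _)) [in RHS](mulrC (_ == _)%:R).
Qed.

End FaceCommutation.

Lemma rmorph_edge_with (A B : comNzRingType) (phi : {rmorphism A -> B}) n
    (mu de : 'I_n -> 'I_n -> 'I_n -> A) (et : 'I_n -> 'I_n -> A)
    (mu' de' : 'I_n -> 'I_n -> 'I_n -> B) (et' : 'I_n -> 'I_n -> B) p u v :
  (forall i j l, phi (mu i j l) = mu' i j l) -> (forall i j l, phi (de i j l) = de' i j l) ->
  (forall i l, phi (et i l) = et' i l) ->
  phi (edge_with mu de et p u v) = edge_with mu' de' et' p u v.
Proof.
move=> hmu hde het; rewrite /edge_with rmorphM rmorph_nat; congr (_ * _).
rewrite /local_edge.
by case: (affected p (gen_state u)) => [|c1 [|c2 [|? ?]]];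
  case: (affected p (gen_state v)) => [|c1' [|c2' [|? ?]]]; rewrite ?rmorph0.
Qed.

Lemma edge_coefE (A : comNzRingType) n (s : A) p (u v : generator n e) :
  edge_coef s p u v = edge_with (@mul_coef A n) (@comul_coef A n) (eta_coef s) p u v.
Proof. by []. Qed.

Definition coef_face (A : comNzRingType) n (s : A) p q a b c
    (f : {ffun circle a -> 'I_n}) (f'' : {ffun circle c -> 'I_n}) : A :=
  face (@mul_coef A n) (@comul_coef A n) (eta_coef s) p q b f f''.

Section ComplexFaces.
Variables (n : nat) (s : algC).
Hypotheses (n_gt0 : (0 < n)%N) (s_sq : s ^+ 2 = n%:R).

Lemma algC_face_commute p q a b b' c (f : {ffun circle a -> 'I_n})
    (f'' : {ffun circle c -> 'I_n}) :
  ~~ a p -> ~~ a q -> p != q -> b = flipped p a -> b' = flipped q a ->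
  c = flipped q b -> c = flipped p b' ->
  coef_face s p q b f f'' = coef_face s q p b' f f''.
Proof.
move=> ap aq pq ab ab' bc bc'.
have [zeta zetaP] := C_prim_root_exists n_gt0.
have zetaP' : n.-primitive_root (zeta%:P : {poly algC}).
  by rewrite (fmorph_primitive_root (@polyC algC)) in zetaP *.
have s_sq' : (s%:P : {poly algC}) ^+ 2 = n%:R by rewrite -rmorphXn /= s_sq rmorph_nat.
have n0 : n%:R != 0 :> {poly algC} by rewrite -(rmorph_nat polyC) polyC_eq0 pnatr_eq0 -lt0n.
have X0 : 'X != 0 :> {poly algC} by rewrite polyX_eq0.
pose at0 : {rmorphism {poly algC} -> algC} := horner_eval 0.
have powE (b0 : bool) (k : nat) : at0 (b0%:R * 'X^k) = (b0 && (k == 0%N))%:R.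
  by rewrite rmorphM rmorph_nat rmorphXn /= /horner_eval hornerX expr0n; case: b0;
    rewrite ?mul1r ?mul0r.
have atface p1 q1 b1 : coef_face s p1 q1 b1 f f'' = at0 (face (deformed_mul 'X)
    (deformed_comul 'X) (deformed_eta 'X s%:P) p1 q1 b1 f f'').
  rewrite /coef_face /face rmorph_sum /=; apply: eq_bigr => f' _; rewrite rmorphM /=.
  (* At ['X = 0] only the exponent 0 survives. As the subtraction is truncated this is just an
     inequality; with the congruence and the range of the indices it becomes the equality of the
     undeformed coefficient. The next two facts go the same way. *)
  have hmu i j l : at0 (deformed_mul 'X i j l) = @mul_coef _ n i j l.
    rewrite powE /mul_coef; congr (nat_of_bool _)%:R; apply/andP/eqP => [[/eqP lij]|->].
      rewrite subn_eq0 => le; have ijn : (i + j < n)%N by apply: leq_ltn_trans le (ltn_ord l).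
      by move: lij; rewrite !modn_small.
    by rewrite eqxx subnn.
  have hde i j l : at0 (deformed_comul 'X i j l) = @comul_coef _ n i j l.
    rewrite powE /comul_coef; congr (nat_of_bool _)%:R; apply/andP/eqP => [[/eqP lij]|->];
      last first.
      by rewrite eqxx subnn.
    rewrite subn_eq0 => le; apply/eqP; rewrite eqn_leq le andbT.
    rewrite leqNgt; apply/negP => lt.
    have /dvdn_leq : (n %| j + l - (i + n./2.*2))%N by rewrite -eqn_mod_dvd ?lij ?(ltnW lt).
    by rewrite subn_gt0 => /(_ lt); have := ltn_ord j; have := ltn_ord l; lia.
  have het (i l : 'I_n) : at0 (deformed_eta 'X s%:P i l) = eta_coef s i l.
    rewrite /deformed_eta rmorphM powE /= /horner_eval hornerC /eta_coef; congr (_ * _).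
    congr (nat_of_bool _)%:R; apply/andP/eqP => [[/eqP lij]|->].
      rewrite subn_eq0 => /leq_ltn_trans/(_ (ltn_ord l)) ijn.
      by move: lij; rewrite !modn_small.
    by rewrite eqxx subnn.
  by congr (_ * _); apply/esym; apply: (rmorph_edge_with _ _ _ hmu hde het).
rewrite !atface; congr (at0 _).
apply: (face_commute (y := point zeta%:P 'X) (theta := half_handle zeta%:P 'X s%:P)
  (dual := dual_point zeta%:P) (kap := fun l : 'I_n => n%:R * 'X^l)) ab ab' bc bc' => //.
- exact: deformed_mul_point.
- exact: deformed_eta_point.
- exact: deformed_comul_point.
- exact: dual_point_point.
- by move=> l; rewrite mulf_neq0 // expf_neq0.
- by move=> g; apply: half_handle_neq0.
Qed.

End ComplexFaces.

(** The exponent of [sqrt n] in an edge coefficient: it depends on the two states but not on the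
    labels, so a whole face has one exponent. *)
Definition eta_count p a b : nat := (size (affected p a) == 1%N) && (size (affected p b) ==
  1%N).

Lemma eta_count_le1 p a b : (eta_count p a b <= 1)%N.
Proof. exact: leq_b1. Qed.

Lemma edge_coef_int (A : comNzRingType) n (s : A) p (u v : generator n e) :
  edge_coef s p u v =
  s ^+ eta_count p (gen_state u) (gen_state v) * (edge_coef (1 : int) p u v)%:~R.
Proof.
rewrite !edge_coefE /edge_with rmorphM rmorph_nat mulrCA; congr (_ * _).
rewrite /local_edge /eta_count.
case: (affected p (gen_state u)) => [|c1 [|c2 [|? ?]]];
  case: (affected p (gen_state v)) => [|c1' [|c2' [|? ?]]]; rewrite /= ?mulr0 ?mul1r //.
- by rewrite /eta_coef mul1r expr1 rmorph_nat.
- by rewrite /comul_coef rmorph_nat.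
- by rewrite /mul_coef rmorph_nat.
Qed.

Lemma coef_face_int (A : comNzRingType) n (s : A) p q a b c
    (f : {ffun circle a -> 'I_n}) (f'' : {ffun circle c -> 'I_n}) :
  coef_face s p q b f f'' =
  s ^+ (eta_count p a b + eta_count q b c) * (coef_face (1 : int) p q b f f'')%:~R.
Proof.
rewrite /coef_face /face rmorph_sum mulr_sumr; apply: eq_bigr => f' _.
transitivity (edge_coef s p (gen f) (gen f') * edge_coef s q (gen f') (gen f'')); first by [].
by rewrite (edge_coef_int s p) (edge_coef_int s q) mulrACA -exprD -rmorphM.
Qed.

Lemma coef_face_commute (A : comNzRingType) n (s : A) p q a b b' c
    (f : {ffun circle a -> 'I_n}) (f'' : {ffun circle c -> 'I_n}) :
  s ^+ 2 = n%:R -> ~~ a p -> ~~ a q -> p != q -> b = flipped p a -> b' = flipped q a ->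
  c = flipped q b -> c = flipped p b' ->
  coef_face s p q b f f'' = coef_face s q p b' f f''.
Proof.
move=> s2 ap aq pq ab ab' bc bc'.
(* Every state has a circle through [p], so for [n = 0] there is no label and hence no [f]. *)
have [n0|n0] := posnP n.
  have [x /andP[nx _]] := at_edge_exists p.
  have := leq_ltn_trans (leq0n _) (ltn_ord (f (exist _ (component a x) (component_circle a
    nx)))).
  by rewrite lt0n => /eqP/(_ n0).
rewrite coef_face_int [RHS]coef_face_int.
have le2 p1 q1 b1 : (eta_count p1 a b1 + eta_count q1 b1 c <= 2)%N.
  exact: leq_add (eta_count_le1 _ _ _) (eta_count_le1 _ _ _).
apply: (sqrt_transfer n0 (le2 p q b) (le2 q p b') s2) => r r2.
by rewrite -!coef_face_int; apply: algC_face_commute.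
Qed.

(** * Signs and the square of the differential *)

Section Differential.
Variables (k : comNzRingType) (n : nat) (sqrtn : k).
Hypothesis hsqrtn : sqrtn ^+ 2 = n%:R.
Local Notation dcoef := (@diff_coef k n sqrtn G e).

Definition flip_sign p a : k := (-1) ^+ (\sum_(r < size e | (r < p)%N) a r)%N.

Lemma flip_sign_flipped p q a : ~~ a p -> p != q ->
  flip_sign q (flipped p a) = (-1) ^+ (p < q)%N * flip_sign q a.
Proof.
move=> ap pq; rewrite /flip_sign -exprD; congr (_ ^+ _).
case: (ltnP p q) => pltq; last first.
  rewrite add0n; apply: eq_bigr => r rq; rewrite ffunE.
  by case: eqP => // rp; rewrite rp ltnNge pltq in rq.
rewrite (bigD1 p) //= ffunE eqxx [in RHS](bigD1 p) //= (negPf ap) add0n; congr (_ + _)%N.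
by apply: eq_bigr => r /andP[_ /negPf rp]; rewrite ffunE rp.
Qed.

Lemma flipped_comm p q a : flipped p (flipped q a) = flipped q (flipped p a).
Proof. by apply/ffunP => r; rewrite !ffunE orbCA. Qed.

Lemma diff_coef_sq (u w : generator n e) : \sum_v dcoef u v * dcoef v w = 0.
Proof.
case: u w => [a f] [c f''].
(* The contribution of flipping [p] and then [q]; the intermediate state is determined, so only its
   labels are summed over, inside [coef_face]. *)
pose t p q : k := (~~ a p && flip_at q (flipped p a) c)%:R *
  (flip_sign p a * flip_sign q (flipped p a) * coef_face sqrtn p q (flipped p a) f f'').
have -> : \sum_v dcoef (gen f) v * dcoef v (gen f'') = \sum_p \sum_q t p q.
  transitivity (\sum_(b : state) \sum_(f' : {ffun circle b -> 'I_n})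
      dcoef (gen f) (gen f') * dcoef (gen f') (gen f'')).
    rewrite (sig_big_dep xpredT (fun _ => xpredT)
      (fun b (f' : {ffun circle b -> 'I_n}) => dcoef (gen f) (gen f') * dcoef (gen f') (gen
        f''))).
    by apply: eq_bigr => -[].
  transitivity (\sum_(b : state) \sum_p \sum_q (flip_at p a b && flip_at q b c)%:R *
      (flip_sign p a * flip_sign q b * coef_face sqrtn p q b f f'')).
    apply: eq_bigr => b _.
    transitivity (\sum_(f' : {ffun circle b -> 'I_n}) \sum_p \sum_q
        (flip_at p a b && flip_at q b c)%:R * (flip_sign p a * flip_sign q b *
        (edge_coef sqrtn p (gen f) (gen f') * edge_coef sqrtn q (gen f') (gen f'')))).
      apply: eq_bigr => f' _; rewrite /diff_coef [X in X * _ = _]big_mkcond mulr_suml.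
      apply: eq_bigr => p _; rewrite [X in _ * X = _]big_mkcond mulr_sumr;
        apply: eq_bigr => q _.
      rewrite [gen_state (gen f)]/= [gen_state (gen f')]/= [gen_state (gen f'')]/=.
      case: (flip_at p a b) => /=; last by rewrite !mul0r.
      case: (flip_at q b c) => /=; last by rewrite mulr0 mul0r.
      by rewrite mul1r mulrACA.
    rewrite exchange_big; apply: eq_bigr => p _; rewrite exchange_big; apply: eq_bigr => q _.
    by rewrite -!mulr_sumr.
  rewrite exchange_big; apply: eq_bigr => p _; rewrite exchange_big; apply: eq_bigr => q _ /=.
  rewrite (bigD1 (flipped p a)) //= big1 ?addr0 => [|b bp].
    by rewrite /t /flip_at eqxx andbT.
  by rewrite {1}/flip_at (negPf bp) andbF mul0r.
apply: antisymmetric_sum => [p|p q pq].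
  by rewrite /t /flip_at ffunE eqxx andbF mul0r.
rewrite /t /flip_at !ffunE !negb_or pq eq_sym pq /= -/(flipped _ _) -/(flipped _ _).
rewrite -/(flipped q (flipped p a)) -/(flipped p (flipped q a)) flipped_comm.
rewrite !andbA [~~ a q && _]andbC.
have : ~~ a p && ~~ a q -> c = flipped q (flipped p a) ->
    coef_face sqrtn p q (flipped p a) f f'' = coef_face sqrtn q p (flipped q a) f f''.
  move=> /andP[ap aq] cE; apply: (coef_face_commute _ _ hsqrtn ap aq pq) => //.
  by rewrite flipped_comm.
move: (coef_face _ _ _ _ _ _) (coef_face _ _ _ _ _ _) => X Y XY.
case: (boolP (~~ a p && ~~ a q)) XY => [/andP[ap aq]|_ _]; last by rewrite !mul0r oppr0.
case: eqP => [cE|_ _]; last by rewrite !mul0r oppr0.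
move/(_ isT); rewrite flipped_comm => /(_ cE) ->; rewrite !mul1r.
rewrite !flip_sign_flipped // 1?eq_sym // -mulNr; congr (_ * _).
(* The first flip changes the sign of the second just when it comes earlier in the enumeration,
   hence for exactly one of the two orders. *)
case: (ltngtP p q) => [||/val_inj pqE]; rewrite ?mul1r ?expr1 ?mulN1r ?expr0.
- by rewrite mulrN mulrC.
- by rewrite mulrN opprK mulrC.
- by rewrite pqE eqxx in pq.
Qed.

Lemma diff_sq (c : chains k n e) : diff sqrtn (diff sqrtn c) = 0.
Proof.
apply/ffunP => w; rewrite !ffunE.
transitivity (\sum_u c u * \sum_v dcoef u v * dcoef v w).
  under eq_bigr do rewrite ffunE mulr_suml.
  rewrite exchange_big; apply: eq_bigr => u _; rewrite mulr_sumr.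
  by apply: eq_bigr => v _; rewrite mulrA.
by rewrite big1 // => u _; rewrite diff_coef_sq mulr0.
Qed.

End Differential.

End Matching.

(** * Bigrading *)

Lemma natr_neq0 (A : nzRingType) (b : bool) : (b%:R : A) != 0 -> b.
Proof. by case: b => //; rewrite eqxx. Qed.

(** All three structure maps lower the degree by [m], which the shift by [m|a|] compensates. *)
Lemma local_edge_degree (k : comNzRingType) (n : nat) (s : k) (S T : finType)
    (u : seq S) (v : seq T) (ms mt : bool) (f : {ffun S -> 'I_n}) (f' : {ffun T -> 'I_n}) :
  flip_shape u v ms mt ->
  local_edge (@mul_coef k n) (@comul_coef k n) (eta_coef s) u v f f' != 0 ->
  \sum_(c | c \notin u) ((n./2)%:Z - (f c : nat)%:Z) =
    \sum_(c | c \notin v) ((n./2)%:Z - (f' c : nat)%:Z) ->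
  \sum_c ((n./2)%:Z - (f c : nat)%:Z) = \sum_c ((n./2)%:Z - (f' c : nat)%:Z) + (n./2)%:Z.
Proof.
move=> shape nz UE.
rewrite (@big_uniq_split _ _ _ _ u); last by case: shape {nz UE} => //= *; rewrite !inE !andbT.
rewrite [in RHS](@big_uniq_split _ _ _ _ v); last by case: shape {nz UE} => //= *;
  rewrite !inE !andbT.
rewrite /= UE [RHS]addrAC; congr (_ + _); move: nz {UE}.
case: shape => [c1 c2 c' _|c c1 c2 _|c c'] /=; rewrite !big_cons !big_nil.
- by move=> /natr_neq0/eqP->; rewrite PoszD; ring.
- by move=> /natr_neq0/eqP/(congr1 Posz); rewrite !PoszD -addnn PoszD; lia.
- rewrite /eta_coef => nz;
  have /natr_neq0/eqP-> : ((f' c' : nat) == f c + n./2)%N%:R != 0 :> k.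
    by apply: contraNneq nz => ->; rewrite mulr0.
  by rewrite PoszD; ring.
Qed.

Section Bigrading.
Variables (G : ribbon_graph) (M : {set {set dart G}}) (e : seq {set dart G}).
Hypotheses (htri : trivalent G) (hM : perfect_matching M) (he : enumerates e M).
Variables (k : comNzRingType) (n : nat) (sqrtn : k).

Lemma weight_flipped p (a : state e) : ~~ a p -> weight (flipped p a) = (weight a).+1.
Proof.
move=> ap; rewrite /weight (bigD1 p) //= ffunE eqxx [in RHS](bigD1 p) //= (negPf ap).
by rewrite add0n add1n; congr _.+1; apply: eq_bigr => q qp; rewrite ffunE (negPf qp).
Qed.

Lemma edge_coef_degree p (u v : generator n e) :
  flip_at p (gen_state u) (gen_state v) -> edge_coef sqrtn p u v != 0 ->
  hdeg v = (hdeg u).+1 /\ qdeg v = qdeg u.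
Proof.
case: u v => [a f] [b f'] /= /andP[ap /eqP ab] nz.
have wb : weight b = (weight a).+1 by rewrite ab; apply: weight_flipped.
split=> //; have [x xp] := at_edge_exists htri hM he p.
have nx : ~~ matched e x by case/andP: xp.
(* Some element of ['I_n] is needed as a default; the label of a circle through [p] supplies one. *)
pose d := f (exist _ (component a x) (component_circle a nx)).
have so : same_outside p (gen f) (gen f').
  by apply: contraNT nz => so; rewrite /edge_coef (negPf so) mul0r.
have loc : local_edge (@mul_coef k n) (@comul_coef k n) (eta_coef sqrtn)
    (affected p a) (affected p b) f f' != 0.
  apply: contraNneq nz => loc; rewrite edge_coefE /edge_with.
  by rewrite [local_edge _ _ _ _ _ _ _]loc mulr0.
have shape := affectedP htri hM he ap ab xp.
rewrite /qdeg /= (local_edge_degree shape loc) ?wb; first by rewrite mulnS PoszD addrA.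
transitivity (\sum_(c : circle a | c \notin affected p a)
    ((n./2)%:Z - (extended d f (val c) : nat)%:Z)).
  by apply: eq_bigr => c _; rewrite extended_val.
transitivity (\sum_(c : circle b | c \notin affected p b)
    ((n./2)%:Z - (extended d f (val c) : nat)%:Z)).
  exact: (big_untouched htri hM he _ (fun s => (n./2)%:Z - (extended d f s : nat)%:Z) ab).
move: so; rewrite (same_outsideE htri hM he d f f' ab) => /forallP so.
by apply: eq_bigr => c cu; have := so c; rewrite cu ffunE => /eqP->.
Qed.

Lemma diff_coef_degree (u v : generator n e) :
  diff_coef sqrtn u v != 0 -> hdeg v = (hdeg u).+1 /\ qdeg v = qdeg u.
Proof.
move=> nz; case: (pickP (fun p => flip_at p (gen_state u) (gen_state v) && (edge_coef sqrtn p
  u v != 0))).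
  by move=> p /andP[]; apply: edge_coef_degree.
move=> no; case/eqP: nz; rewrite /diff_coef big1 // => p uv.
by have := no p; rewrite uv /= => /negbFE/eqP->; rewrite mulr0.
Qed.

Lemma bigraded_complexP : sqrtn ^+ 2 = n%:R -> bigraded_complex n sqrtn e.
Proof.
move=> s2; split=> [i j c /forallP hc|c]; last by apply: (diff_sq htri hM he s2 c).
apply/forallP => v; apply/implyP; rewrite ffunE => nz.
case: (pickP (fun u => c u * diff_coef sqrtn u v != 0)) => [u nzu|no]; last first.
  by case/eqP: nz; rewrite big1 // => u _; move/negbFE/eqP: (no u).
have cu : c u != 0 by apply: contraNneq nzu => ->; rewrite mul0r.
have /diff_coef_degree[-> ->] : diff_coef sqrtn u v != 0.
  by apply: contraNneq nzu => ->; rewrite mulr0.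
have := hc u; rewrite cu /= => /andP[/eqP <- ->].
by rewrite andbT -natz -addn1 natrD natz eqxx.
Qed.

End Bigrading.

(** * Invariance of the homology *)

Section ChainMap.
Variables (k : comNzRingType) (n : nat) (s : k) (i j : int).
Variables (G G' : ribbon_graph) (e : seq {set dart G}) (e' : seq {set dart G'}).
Variable F : {linear chains k n e -> chains k n e'}.
Hypothesis F_diff : forall c, diff s (F c) = F (diff s c).
Hypothesis F_homog : forall i c, homog i j c -> homog i j (F c).

Lemma chain_map_cycle (z : cycles n s e i j) : F (cycle_val z) \in is_cycle s i j.
Proof.
case: z => z /=; rewrite !unfold_in => /andP[hz /eqP dz].
by rewrite F_homog // F_diff dz linear0 eqxx.
Qed.

Definition cycle_map (z : cycles n s e i j) : cycles n s e' i j :=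
  Cycle (chain_map_cycle z).

Definition homology_map (x : homology n s e i j) : homology n s e' i j :=
  proj (is_boundary_submod n s e' i j) (cycle_map (sval (proj_surj x))).

Lemma homology_map_proj z :
  homology_map (proj (is_boundary_submod n s e i j) z) =
  proj (is_boundary_submod n s e' i j) (cycle_map z).
Proof.
rewrite /homology_map; case: proj_surj => w /= /eqP; rewrite proj_eq => /asboolP[b hb db].
apply/esym/eqP; rewrite proj_eq; apply/asboolP; exists (F b); first exact: F_homog.
by rewrite F_diff db /= linearB.
Qed.

Lemma homology_map_linear : linear homology_map.
Proof.
move=> a x y; have [z ->] := proj_surj x; have [w ->] := proj_surj y.
have scaleE : a *: proj (is_boundary_submod n s e i j) z =
    proj (is_boundary_submod n s e i j) (a *: z) := mquot_scale_proj _ a z.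
have scaleE' : a *: proj (is_boundary_submod n s e' i j) (cycle_map z) =
    proj (is_boundary_submod n s e' i j) (a *: cycle_map z) := mquot_scale_proj _ a _.
rewrite scaleE -projD !homology_map_proj scaleE' -projD.
by congr proj; apply: val_inj => /=; rewrite linearP.
Qed.

HB.instance Definition _ := GRing.isLinear.Build k (homology n s e i j)
  (homology n s e' i j) _ homology_map homology_map_linear.

End ChainMap.

Lemma chain_iso_homology (k : comNzRingType) (n : nat) (s : k) (i j : int)
    (G G' : ribbon_graph) (e : seq {set dart G}) (e' : seq {set dart G'})
    (F : {linear chains k n e -> chains k n e'}) (F' : {linear chains k n e' -> chains k n
      e}) :
  cancel F F' -> cancel F' F -> (forall c, diff s (F c) = F (diff s c)) ->
  (forall i c, homog i j (F c) = homog i j c) ->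
  isomorphic (homology n s e i j) (homology n s e' i j).
Proof.
move=> FK F'K Fd Fh.
have Fh1 i' c : homog i' j c -> homog i' j (F c) by rewrite Fh.
have F'h i' c : homog i' j c -> homog i' j (F' c) by rewrite -Fh F'K.
have F'd c : diff s (F' c) = F' (diff s c) by rewrite -{2}[c]F'K Fd FK.
pose L : {linear homology n s e i j -> homology n s e' i j} := homology_map (i := i) Fd Fh1.
exists L; exists (homology_map F'd F'h) => x; have [z ->] := proj_surj x.
  rewrite [L _](homology_map_proj Fd Fh1) (homology_map_proj F'd F'h).
  by congr proj; apply: val_inj; rewrite /= FK.
rewrite (homology_map_proj F'd F'h) [L _](homology_map_proj Fd Fh1).
by congr proj; apply: val_inj; rewrite /= F'K.
Qed.

Lemma perm_eq_seq2 (T : eqType) (s : seq T) (x y : T) :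
  perm_eq s [:: x; y] -> s = [:: x; y] \/ s = [:: y; x].
Proof.
move=> sp; have := perm_size sp; case: s sp => [|a [|b [|? ?]]] // /perm_consP.
case=> [[|[|i]]] [u [ru /perm_small_eq us]] _ //=.
- by left; move: ru; rewrite /rot /= (us isT) => -[-> ->].
- by right; move: ru; rewrite /rot /= (us isT) => -[-> ->].
- by move: ru; rewrite /rot /= (us isT) => -[-> ->]; left.
Qed.

(** A bijection of circles may exchange the order in which the two affected ones are enumerated;
    commutativity and cocommutativity absorb this. *)
Lemma local_edge_perm (n : nat) (A : pzSemiRingType) (mu de : 'I_n -> 'I_n -> 'I_n -> A)
    (et : 'I_n -> 'I_n -> A) (S S' T T' : finType) (hs : S -> S') (ht : T -> T')
    (s : seq S) (s' : seq S') (t : seq T) (t' : seq T')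
    (f : {ffun S -> 'I_n}) (f' : {ffun S' -> 'I_n})
    (g : {ffun T -> 'I_n}) (g' : {ffun T' -> 'I_n}) :
  (forall i j l, mu i j l = mu j i l) -> (forall l i j, de l i j = de l j i) ->
  perm_eq s' (map hs s) -> perm_eq t' (map ht t) ->
  (forall c, f' (hs c) = f c) -> (forall c, g' (ht c) = g c) ->
  local_edge mu de et s' t' f' g' = local_edge mu de et s t f g.
Proof.
move=> muC deC ps pt ff gg; have := perm_size ps; have := perm_size pt.
have p1 (U : eqType) (r : seq U) x : perm_eq r [:: x] -> r = [:: x].
  by move/perm_small_eq=> -> //.
rewrite !size_map /local_edge => zt zs.
case: s ps zs => [|c1 [|c2 [|c3 s]]] /= ps zs; case: t pt zt => [|d1 [|d2 [|d3 t]]] /= pt zt;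
  try by move: zs zt; case: (s') => [|? [|? [|? ?]]] //; case: (t') => [|? [|? [|? ?]]] //.
- by rewrite (p1 _ _ _ ps) (p1 _ _ _ pt) ff gg.
- by rewrite (p1 _ _ _ ps); case: (perm_eq_seq2 pt) => ->; rewrite ff !gg.
- by case: (perm_eq_seq2 ps) => ->; rewrite (p1 _ _ _ pt) !ff gg.
Qed.

(** * Signs under a change of enumeration *)

Section Inversions.
Variables (n n' : nat) (pi : 'I_n -> 'I_n').
Hypothesis pi_inj : injective pi.

(* Changing the enumeration of the matching by [pi] changes the sign of a
   generator according to the inversions of [pi] on its 1-smoothed edges. *)
Definition inversions (a : 'I_n -> bool) : nat :=
  (\sum_(r < n) \sum_(t < n) ((r < t) && (pi t < pi r)) * (a r * a t))%N.

Lemma inversions_add p (a b : 'I_n -> bool) : ~~ a p -> (forall r, b r = (r == p) || a r) ->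
  (inversions b + \sum_(r < n | r < p) a r =
   inversions a + \sum_(r < n | pi r < pi p) a r + (\sum_(r < n) ((r < p) && (pi p < pi r)) *
     a r).*2)%N.
Proof.
move=> ap ba; have bE r : (b r = (r == p) + a r :> nat)%N.
  by rewrite ba; case: eqP => // ->; rewrite (negPf ap).
pose K (r t : 'I_n) : nat := ((r < t) && (pi t < pi r))%N.
have sum1 : (\sum_(r < n) (r == p) = 1)%N.
  by rewrite (bigD1 p) //= eqxx big1 // => t /negPf->.
have KE : (inversions b =
  inversions a + \sum_(t < n) K p t * a t + \sum_(r < n) K r p * a r)%N.
  have -> : (inversions b = \sum_(r < n) (\sum_(t < n) K r t * (a r * a t) +
      (r == p) * (\sum_(t < n) K p t * a t) + K r p * a r))%N.
    apply: eq_bigr => r _.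
    have -> : (\sum_(t < n) K r t * (b r * b t) = \sum_(t < n) (K r t * (a r * a t) +
        (r == p) * (K p t * a t) + (t == p) * (K r p * a r)))%N.
      apply: eq_bigr => t _; rewrite !bE.
      have [->|rp] := eqVneq r p; have [->|tp] := eqVneq t p;
        rewrite /K ?ltnn ?(negPf ap) /=; lia.
    rewrite !big_split /= -big_distrr /=; congr (_ + _)%N.
    by rewrite -big_distrl /= sum1 mul1n.
  rewrite !big_split /=; congr (_ + _ + _)%N.
  by rewrite -big_distrl /= sum1 mul1n.
rewrite KE -!addnA; congr (_ + _)%N.
rewrite -muln2 big_distrl /= [in LHS](big_mkcond (fun r : 'I_n => r < p)%N).
rewrite [in RHS](big_mkcond (fun r : 'I_n => pi r < pi p)%N) /= -!big_split /=.
apply: eq_bigr => r _; rewrite /K.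
have [->|rp] := eqVneq r p; first by rewrite !ltnn (negPf ap).
have pirp : val (pi r) != val (pi p) by rewrite (inj_eq val_inj) (inj_eq pi_inj).
move: rp pirp; rewrite -(inj_eq val_inj) /=.
by case: (ltngtP r p) => // _ _; case: (ltngtP (pi r) (pi p)) => //= _ _; case: (a r).
Qed.

End Inversions.

Section Transport.
Variables (G G' : ribbon_graph) (e : seq {set dart G}) (e' : seq {set dart G'}).
Variables (phi : dart G -> dart G') (psi : dart G' -> dart G) (eps : dart G -> bool).
Hypotheses (phiK : cancel phi psi) (psiK : cancel psi phi).
Hypothesis eps_rotation : forall h, eps (rotation G h) = eps h.
Hypothesis phi_rotation : forall h, phi (rotation G h) =
  if eps h then (rotation G')^-1%g (phi h) else rotation G' (phi h).
Hypothesis phi_opposite : forall h, phi (opposite h) = opposite (phi h) /\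
  twist (phi h) = twist h (+) eps h (+) eps (opposite h).
Variables (pi : 'I_(size e) -> 'I_(size e')) (pi' : 'I_(size e') -> 'I_(size e)).
Hypotheses (piK : cancel pi pi') (pi'K : cancel pi' pi).
Hypothesis pi_medge : forall p, medge (pi p) = phi @: medge p.

Let phi_inj : injective phi := can_inj phiK.
Let pi_inj : injective pi := can_inj piK.

Definition transport_state (a : state e) : state e' := [ffun q => a (pi' q)].
Local Notation sigma := transport_state.

Lemma transport_stateE a p : sigma a (pi p) = a p.
Proof. by rewrite ffunE piK. Qed.

Lemma transport_state_inj : injective sigma.
Proof. by move=> a b ab; apply/ffunP => p; rewrite -!transport_stateE ab. Qed.

Lemma transport_state_surj a' : exists a, sigma a = a'.
Proof. by exists [ffun p => a' (pi p)]; apply/ffunP => q; rewrite !ffunE pi'K. Qed.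

Lemma transport_flip_at p a b : flip_at (pi p) (sigma a) (sigma b) = flip_at p a b.
Proof.
rewrite /flip_at transport_stateE; congr (_ && _).
rewrite -(inj_eq transport_state_inj b); congr (_ == _).
apply/ffunP => q; rewrite !ffunE.
by rewrite -{1}(pi'K q) (inj_eq pi_inj).
Qed.

Lemma weight_transport a : weight (sigma a) = weight a.
Proof.
rewrite /weight (reindex pi) /=; last by exists pi' => ? _; rewrite ?piK ?pi'K.
by apply: eq_bigr => p _; rewrite transport_stateE.
Qed.

Lemma phi_side b h : phi (side b h) = side (b (+) eps h) (phi h).
Proof.
case: b; rewrite /side; first by rewrite phi_rotation; case: (eps h).
pose g := ((rotation G)^-1 h)%g; have gh : rotation G g = h by rewrite /g permKV.
have eg : eps g = eps h by rewrite -gh eps_rotation.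
have := phi_rotation g; rewrite gh eg /= -/g => ->.
by case: (eps h); rewrite ?permKV ?permK.
Qed.

(** Reversing the vertex of [h] exchanges the sides of [h] and also changes the twist. The two
    effects cancel at the far end, where only the reversal of that vertex remains, as [phi_side]
    requires. *)
Lemma transport_joined a x y : joined (sigma a) (phi x) (phi y) = joined a x y.
Proof.
have tw h b u : side (~~ (b (+) eps h) (+) twist (phi h) (+) u) (opposite (phi h)) =
    phi (side (~~ b (+) twist h (+) u) (opposite h)).
  have [<- ->] := phi_opposite h; rewrite phi_side; congr side.
  by case: b; case: (eps h); case: (eps (opposite h)); case: (twist h); case: u.
apply/existsP/existsP => -[p].
  rewrite -(pi'K p) transport_stateE pi_medge.
  move=> /existsP[_ /andP[/imsetP[h hp ->] /existsP[b]]].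
  rewrite -[b](addbK (eps h)) -phi_side tw !(inj_eq phi_inj) => H.
  exists (pi' p); apply/existsP; exists h; rewrite hp.
  by apply/existsP; exists (b (+) eps h).
move=> /existsP[h /andP[hp /existsP[b /andP[/eqP-> /eqP->]]]].
exists (pi p); apply/existsP; exists (phi h); rewrite pi_medge imset_f //=.
apply/existsP; exists (b (+) eps h).
by rewrite transport_stateE tw phi_side !eqxx.
Qed.

Lemma transport_linked a x y : linked (sigma a) (phi x) (phi y) = linked a x y.
Proof.
by rewrite /linked transport_joined -(phi_opposite x).1 (inj_eq phi_inj).
Qed.

Lemma transport_connect a x y :
  connect (linked (sigma a)) (phi x) (phi y) = connect (linked a) x y.
Proof.
apply/connectP/connectP => -[s sp lst].
  exists (map psi s); last by rewrite -(phiK x) last_map -lst phiK.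
  rewrite -(phiK x) path_map; apply: sub_path sp => u v /=.
  by rewrite -{1}(psiK u) -{1}(psiK v) transport_linked.
exists (map phi s); last by rewrite last_map lst.
rewrite path_map; apply: sub_path sp => u v /=.
by rewrite transport_linked.
Qed.

Lemma transport_component a x :
  [set y | connect (linked (sigma a)) (phi x) y] = phi @: [set y | connect (linked a) x y].
Proof.
apply/setP => y; rewrite -(psiK y) (mem_imset _ _ phi_inj) !inE.
exact: transport_connect.
Qed.

Lemma transport_edge x : edge (phi x) = phi @: edge x.
Proof. by rewrite /edge imsetU !imset_set1 (phi_opposite x).1. Qed.

Lemma transport_matched x : (edge (phi x) \in e') = (edge x \in e).
Proof.
rewrite transport_edge; apply/idP/idP.
  move/(tnthP (in_tuple e')) => [q]; rewrite -(pi'K q) => xq.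
  have := pi_medge (pi' q); rewrite /medge -xq => /(imset_inj phi_inj) ->.
  exact: mem_tnth.
move/(tnthP (in_tuple e)) => [p ->].
have := pi_medge p; rewrite /medge => <-; exact: mem_tnth.
Qed.

Lemma transport_circles a (c : {set dart G}) : (phi @: c \in circles (sigma a)) =
  (c \in circles a).
Proof.
apply/imsetP/imsetP => -[x]; rewrite !inE => xe cx.
  exists (psi x); rewrite ?inE -1?transport_matched ?psiK //.
  by apply: (imset_inj phi_inj); rewrite cx -{1}(psiK x) transport_component.
by exists (phi x); rewrite ?inE ?transport_matched // cx transport_component.
Qed.

Definition push_circle a (c : circle a) : circle (sigma a) :=
  exist _ (phi @: val c) (etrans (transport_circles a (val c)) (valP c)).

Lemma pull_circle_subproof a (c : circle (sigma a)) : psi @: val c \in circles a.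
Proof.
rewrite -transport_circles -imset_comp.
suff -> : (phi \o psi) @: val c = val c by exact: valP.
by rewrite (eq_imset _ (g := id)) ?imset_id // => x /=; rewrite psiK.
Qed.

Definition pull_circle a (c : circle (sigma a)) : circle a :=
  exist _ (psi @: val c) (pull_circle_subproof c).

Lemma push_circleK a : cancel (@push_circle a) (@pull_circle a).
Proof.
move=> c; apply: val_inj => /=; rewrite -imset_comp.
by rewrite (eq_imset _ (g := id)) ?imset_id // => x /=; rewrite phiK.
Qed.

Lemma pull_circleK a : cancel (@pull_circle a) (@push_circle a).
Proof.
move=> c; apply: val_inj => /=; rewrite -imset_comp.
by rewrite (eq_imset _ (g := id)) ?imset_id // => x /=; rewrite psiK.
Qed.

Lemma transport_touches p (c : {set dart G}) : touches (pi p) (phi @: c) = touches p c.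
Proof.
apply/existsP/existsP => -[h].
  rewrite pi_medge => /andP[/imsetP[g gp ->] /existsP[b]].
  rewrite -[b](addbK (eps g)) -phi_side (mem_imset _ _ phi_inj) => bc.
  by exists g; rewrite gp; apply/existsP; exists (b (+) eps g).
move=> /andP[hp /existsP[b bc]]; exists (phi h); rewrite pi_medge imset_f //=.
by apply/existsP; exists (b (+) eps h); rewrite -phi_side (mem_imset _ _ phi_inj).
Qed.

Section Generators.
Variable n : nat.

Definition transport_gen (u : generator n e) : generator n e' :=
  gen [ffun c : circle (sigma (gen_state u)) => gen_label u (pull_circle c)].

Lemma transport_gen_inj : injective transport_gen.
Proof.
move=> [a f] [b g] uv.
have ab : a = b by apply: transport_state_inj; exact: (congr1 tag uv).
case: b / ab g uv => g /eqP; rewrite /transport_gen /gen eq_Tagged /= => /eqP/ffunP fg.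
congr Tagged; apply/ffunP => c; have := fg (push_circle c).
by rewrite !ffunE push_circleK.
Qed.

Lemma transport_gen_surj v : exists u, transport_gen u = v.
Proof.
case: v => [b g]; have [a ab] := transport_state_surj b.
case: b / ab g => g; exists (gen [ffun c : circle a => g (push_circle c)]).
rewrite /transport_gen /gen /=; congr Tagged; apply/ffunP => c.
by rewrite !ffunE pull_circleK.
Qed.

Lemma transport_gen_bij : exists2 w, cancel transport_gen w & cancel w transport_gen.
Proof.
have /fin_all_exists[w wK] := transport_gen_surj.
by exists w => // u; apply: transport_gen_inj; rewrite wK.
Qed.

Lemma hdeg_transport u : hdeg (transport_gen u) = hdeg u.
Proof. exact: weight_transport. Qed.

Lemma qdeg_transport u : qdeg (transport_gen u) = qdeg u.
Proof.
rewrite /qdeg [gen_state (transport_gen u)]/= weight_transport; congr (_ + _).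
rewrite (reindex (@push_circle (gen_state u))) /=; last first.
  by exists (@pull_circle _) => c _; rewrite ?push_circleK ?pull_circleK.
by apply: eq_bigr => c _; rewrite /gen_label /= ffunE push_circleK.
Qed.

Lemma transport_affected p a :
  perm_eq (affected (pi p) (sigma a)) (map (@push_circle a) (affected p a)).
Proof.
apply: uniq_perm; first exact: affected_uniq.
  by rewrite map_inj_uniq ?affected_uniq //; exact: can_inj (@push_circleK a).
move=> c; rewrite -(pull_circleK c) mem_map; last exact: can_inj (@push_circleK a).
by rewrite !affected_mem transport_touches.
Qed.

Lemma transport_label u (c : circle (gen_state u)) :
  gen_label (transport_gen u) (push_circle c) = gen_label u c.
Proof.
have : gen_label (transport_gen u) (push_circle c) = gen_label u (pull_circle (push_circle c)).
  exact: ffunE.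
by rewrite push_circleK.
Qed.

Lemma transport_same_outside p u v :
  same_outside (pi p) (transport_gen u) (transport_gen v) = same_outside p u v.
Proof.
have step (c : circle (gen_state u)) (d : circle (gen_state v)) :
    ((val (push_circle c) == val (push_circle d)) && ~~ touches (pi p) (val (push_circle c))
      ==>
      (gen_label (transport_gen u) (push_circle c) == gen_label (transport_gen v)
        (push_circle d)))
    = ((val c == val d) && ~~ touches p (val c) ==> (gen_label u c == gen_label v d)).
  congr (_ && ~~ _ ==> _).
  - exact: (inj_eq (imset_inj phi_inj)).
  - exact: transport_touches.
  - by congr (_ == _); exact: transport_label.
apply/forallP/forallP => H c; apply/forallP => d.
  by have /forallP/(_ (push_circle d)) := H (push_circle c); rewrite (step c d).
have /forallP/(_ (pull_circle d)) := H (pull_circle c).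
have := step (pull_circle c) (pull_circle d).
have -> : push_circle (pull_circle c) = c := pull_circleK c.
have -> : push_circle (pull_circle d) = d := pull_circleK d.
by move=> <-.
Qed.

Section Coefficients.
Variables (k : comNzRingType) (s : k).

Lemma transport_edge_coef p u v :
  edge_coef s (pi p) (transport_gen u) (transport_gen v) = edge_coef s p u v.
Proof.
rewrite !edge_coefE /edge_with transport_same_outside; congr (_ * _).
apply: (local_edge_perm _ _ _ (transport_affected p _) (transport_affected p _)).
- by move=> i j l; rewrite /mul_coef addnC.
- by move=> l i j; rewrite /comul_coef addnC.
- exact: transport_label.
- exact: transport_label.
Qed.

Definition transport_sign (u : generator n e) : k := (-1) ^+ inversions pi (gen_state u).

(** As signs are their own inverses, this says that the relabelling of generators multiplied by
    [transport_sign] commutes with the differentials. *)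
Lemma transport_diff_coef u v :
  diff_coef s (transport_gen u) (transport_gen v) =
  transport_sign u * transport_sign v * diff_coef s u v.
Proof.
rewrite /diff_coef mulr_sumr (reindex pi) /=; last first.
  by exists pi' => ? _; rewrite ?piK ?pi'K.
apply: eq_big => [p|p]; first exact: transport_flip_at.
rewrite transport_flip_at transport_edge_coef [RHS]mulrA => /andP[ap /eqP uv]; congr (_ * _).
rewrite /transport_sign -!exprD -signr_odd -[RHS]signr_odd; congr (_ ^+ nat_of_bool _).
have -> : (\sum_(q < size e' | q < pi p) sigma (gen_state u) q =
    \sum_(r < size e | pi r < pi p) gen_state u r)%N.
  rewrite (reindex pi) /=; last by exists pi' => ? _; rewrite ?piK ?pi'K.
  by apply: eq_bigr => r _; rewrite transport_stateE.
have := @inversions_add _ _ pi pi_inj p (gen_state u) (gen_state v) ap.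
rewrite {1}uv => /(_ (fun r => ffunE _ r)) /(congr1 odd); rewrite !oddD odd_double addbF.
by case: odd => //; case: odd => //; case: odd => //; case: odd.
Qed.

End Coefficients.
End Generators.
End Transport.

Section SignedRelabelling.
Variables (k : comNzRingType) (n : nat) (G G' : ribbon_graph).
Variables (e : seq {set dart G}) (e' : seq {set dart G'}).
Variables (sg : generator n e -> k) (w : generator n e' -> generator n e).

Definition relabel (c : chains k n e) : chains k n e' := [ffun v => sg (w v) * c (w v)].

Lemma relabel_linear : linear relabel.
Proof.
move=> a c d; apply/ffunP => v; rewrite !ffunE mulrDr; congr (_ + _).
exact: mulrCA.
Qed.
HB.instance Definition _ := GRing.isLinear.Build k _ _ _ relabel relabel_linear.

End SignedRelabelling.

Lemma equivalent_homology (k : comNzRingType) (n : nat) (s : k) (G G' : ribbon_graph)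
    (M : {set {set dart G}}) (M' : {set {set dart G'}})
    (e : seq {set dart G}) (e' : seq {set dart G'}) (i j : int) :
  enumerates e M -> equivalent M M' -> enumerates e' M' ->
  isomorphic (homology n s e i j) (homology n s e' i j).
Proof.
move=> [ue eM] [phi [eps [[psi phiK psiK] eps_rot phi_rot phi_opp MM']]] [ue' eM'].
have phi_inj := can_inj phiK.
have size_e : size e = size e'.
  rewrite -(card_uniqP ue) -(card_uniqP ue') (eq_card eM) (eq_card eM') -MM'.
  by rewrite card_imset //; apply: imset_inj.
have /fin_all_exists[pi piE] (p : 'I_(size e)) : exists q : 'I_(size e'),
  medge q = phi @: medge p.
  have : phi @: medge p \in e' by rewrite eM' -MM' imset_f // -eM; exact: mem_tnth.
  by move/(tnthP (in_tuple e')) => [q ->]; exists q.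
have pi_inj : injective pi.
  move=> p q pq; have : medge p = medge q.
    by apply: (imset_inj phi_inj); rewrite -!piE pq.
  rewrite /medge !(tnth_nth set0) /= => /eqP.
  by rewrite nth_uniq // => /eqP/val_inj.
have [pi' piK pi'K] : bijective pi by apply: inj_card_bij; rewrite // !card_ord size_e.
pose T : generator n e -> generator n e' :=
  transport_gen (n := n) phiK psiK eps_rot phi_rot phi_opp piK pi'K piE.
have [w wK Kw] : exists2 w, cancel T w & cancel w T by exact: transport_gen_bij.
have hdegT u : hdeg (T u) = hdeg u by exact: hdeg_transport.
have qdegT u : qdeg (T u) = qdeg u by exact: qdeg_transport.
pose sg := transport_sign pi (n := n) k : generator n e -> k.
have sg2 u : sg u * sg u = 1 by rewrite -expr2 sqrr_sign.
have T_coef u v : diff_coef s (T u) (T v) = sg u * sg v * diff_coef s u v.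
  exact: transport_diff_coef.
pose F : {linear chains k n e -> chains k n e'} := relabel sg w.
pose F' : {linear chains k n e' -> chains k n e} := relabel (sg \o w) T.
apply: (@chain_iso_homology _ _ _ _ _ _ _ _ _ F F').
- by move=> c; apply/ffunP => u; rewrite !ffunE /= wK mulrA sg2 mul1r.
- by move=> c; apply/ffunP => u; rewrite !ffunE /= Kw mulrA sg2 mul1r.
- move=> c; apply/ffunP => v; rewrite !ffunE mulr_sumr (reindex T) /=; last first.
    by exists w => ? _.
  apply: eq_bigr => u _; rewrite !ffunE wK -{1}(Kw v) T_coef.
  by rewrite mulrACA [sg u * (_ * _)]mulrA sg2 mul1r.
- move=> i' c; apply/forallP/forallP => H u.
    have := H (T u); rewrite ffunE wK hdegT qdegT.
    apply: contraTT; rewrite !negb_imply => /andP[cu ->]; rewrite andbT.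
    by apply: contraNneq cu => scu; rewrite -[c u]mul1r -(sg2 u) -mulrA scu mulr0.
  rewrite -(Kw u) hdegT qdegT.
  have := H (w u); apply: contraTT; rewrite !negb_imply => /andP[cu ->]; rewrite andbT.
  by apply: contraNneq cu => scu; rewrite ffunE wK scu mulr0.
Qed.

(** * Ranks and the Euler characteristic *)

Definition independent (k : comNzRingType) (H : lmodType k) (r : nat) (x : 'I_r -> H) : Prop :=
  forall a : 'I_r -> k, \sum_i a i *: x i = 0 -> forall i, a i = 0.

(** A maximal independent family works: adding any [y] creates a relation, whose coefficient at [y]
    is nonzero by independence and so regular in a domain. *)
Lemma bounded_has_rank (k : comNzRingType) (H : lmodType k) (N : nat) :
  integral_domain k -> (forall r (x : 'I_r -> H), independent x -> (r <= N)%N) ->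
  exists r, has_rank H r.
Proof.
move=> dom bnd.
pose P r := `[< exists x : 'I_r -> H, independent x >].
have P0 : exists r, P r by exists 0%N; apply/asboolP; exists (fun=> 0) => a _ [].
have PN r : P r -> (r <= N)%N by move/asboolP=> [x]; apply: bnd.
case: (ex_maxnP P0 PN) => r /asboolP[x xi] rmax; exists r, x; split=> // y.
have : ~ exists x' : 'I_r.+1 -> H, independent x'.
  by move=> ex; have := rmax r.+1; rewrite ltnn => /(_ (introT (asboolP _) ex)).
pose x' (i : 'I_r.+1) := if unlift ord0 i is Some l then x l else y.
move=> /forallNP/(_ x')/existsNP[a /not_implyP[a0 /existsNP[i0 ai0]]].
have ax : a ord0 *: y + \sum_l a (lift ord0 l) *: x l = 0.
  rewrite -[RHS]a0 big_ord_recl /x' unlift_none; congr (_ + _).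
  by apply: eq_bigr => l _; rewrite liftK.
have c0 : a ord0 <> 0.
  move=> c0; move: ax; rewrite c0 scale0r add0r => /xi al; case: ai0.
  by case: (unliftP ord0 i0) => [l ->|->]; rewrite ?al.
exists (a ord0).
  move=> u v uv; apply/eqP; rewrite -subr_eq0; apply/eqP.
  by case: (dom (a ord0) (u - v)) => //; rewrite mulrBr uv subrr.
exists (fun l => - a (lift ord0 l)); apply/eqP; rewrite -subr_eq0 -[X in _ == X]ax.
by rewrite -sumrN; under eq_bigr do rewrite scaleNr opprK.
Qed.

Section HomologyRank.
Variables (k : comNzRingType) (n : nat) (s : k) (G : ribbon_graph) (e : seq {set dart G}).
Variables (i j : int).
Local Notation H := (homology n s e i j).
Local Notation class := (proj (is_boundary_submod n s e i j)).

Lemma class0 : class 0 = 0.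
Proof. by apply: (addrI (class 0)); rewrite -projD !addr0. Qed.

Lemma class_sum (I : finType) (a : I -> k) (z : I -> cycles n s e i j) :
  \sum_l a l *: class (z l) = class (\sum_l a l *: z l).
Proof.
apply: (big_ind2 (fun u v => u = class v)).
- by rewrite class0.
- by move=> _ u _ v -> ->; rewrite projD.
- by move=> l _; apply: mquot_scale_proj.
Qed.

Lemma cycle_val_sum (I : finType) (a : I -> k) (z : I -> cycles n s e i j) :
  cycle_val (\sum_l a l *: z l) = \sum_l a l *: cycle_val (z l).
Proof. by apply: (big_ind2 (fun u v => cycle_val u = v)) => // ? _ ? _ <- <-. Qed.

Lemma class_eq0 (z : cycles n s e i j) :
  class z = 0 <-> exists2 b, homog (i - 1) j b & diff s b = cycle_val z.
Proof.
have -> : class z = 0 <-> is_boundary z.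
  rewrite -class0; split=> [/eqP|bz]; first by rewrite proj_eq subr0.
  by apply/eqP; rewrite proj_eq subr0.
by split=> [/asboolP|bz]; last exact/asboolP.
Qed.

(** Cycles representing independent classes are independent in the free module of chains, which
    bounds their number. *)
Lemma independent_homology r (x : 'I_r -> H) :
  independent x -> (r <= #|{: generator n e}|)%N.
Proof.
have /fin_all_exists[z zx] l : exists z, x l = class z by have [z] := proj_surj (x l);
  exists z.
move=> xi; rewrite -[r]card_ord.
apply: (@injective_leq_card k _ _ (fun l b => cycle_val (z l) b)) => a az; apply: xi.
under eq_bigr do rewrite zx.
rewrite class_sum; apply/class_eq0; exists 0; first exact: homog0.
rewrite linear0 cycle_val_sum; apply/ffunP => b; rewrite ffunE sum_ffunE -[LHS](az b).
by apply: eq_bigr => l _; rewrite ffunE.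
Qed.

Lemma rank_support r : has_rank H r -> (forall b : generator n e,
  ((hdeg b)%:Z == i) && (qdeg b == j) = false) ->
  r = 0%N.
Proof.
move=> [x [xi _]] no; case: r x xi => // r x xi; exfalso.
have [z zx] := proj_surj (x ord0).
have z0 : cycle_val z = 0.
  case: z {zx} => z /=; rewrite unfold_in => /andP[/forallP hz _].
  apply/ffunP => b; rewrite ffunE; apply/eqP; have := hz b; rewrite no implybF negbK.
  by [].
have := xi (fun l => (l == ord0)%:R); rewrite (bigD1 ord0) //= big1 => [|l /negPf->];
  last exact: scale0r.
rewrite scale1r addr0 zx => /(_ _ ord0); rewrite eqxx => H1.
have : (1 : k) = 0.
  by apply: H1; apply/class_eq0; exists 0; [exact: homog0|rewrite linear0 z0].
by move/eqP; rewrite oner_eq0.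
Qed.

End HomologyRank.

Lemma homology_has_rank (k : comNzRingType) (n : nat) (s : k) (G : ribbon_graph)
    (e : seq {set dart G}) :
  integral_domain k ->
  exists r : int -> int -> nat, forall i j, has_rank (homology n s e i j) (r i j).
Proof.
move=> dom.
have [f fP] := @choice _ _ (fun ij r => has_rank (homology n s e ij.1 ij.2) r)
  (fun ij => bounded_has_rank dom (@independent_homology k n s G e ij.1 ij.2)).
by exists (fun i j => f (i, j)) => i j; exact: (fP (i, j)).
Qed.

Section EulerCharacteristic.
Variables (G : ribbon_graph) (M : {set {set dart G}}) (e : seq {set dart G}).
Hypotheses (htri : trivalent G) (hM : perfect_matching M) (he : enumerates e M).
Variables (k : comNzRingType) (n : nat) (s : k).
Hypothesis s_sq : s ^+ 2 = n%:R.
Variable r : int -> int -> nat.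
Hypothesis r_rank : forall i j : int, has_rank (homology n s e i j) (r i j).
Variable j : int.

Local Notation chains := (chains k n e).
Local Notation diff := (diff s).
Local Notation class i := (proj (is_boundary_submod n s e i j)).

Definition pure (c : chains) : Prop := forall b, c b != 0 -> qdeg b = j.

Definition hdeg_part (i : int) (c : chains) : chains :=
  [ffun b => if (hdeg b)%:Z == i then c b else 0].

Lemma homog_pure i (c : chains) : homog i j c -> pure c.
Proof. by move=> /forallP hc b cb; have := hc b; rewrite cb => /andP[_ /eqP]. Qed.

Lemma hdeg_part_homog i (c : chains) : pure c -> homog i j (hdeg_part i c).
Proof.
move=> pc; apply/forallP => b; apply/implyP; rewrite ffunE.
by case: ((hdeg b)%:Z =P i) => [_ cb|_]; [rewrite (pc b cb) eqxx | rewrite eqxx].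
Qed.

Lemma hdeg_part_id i i' (c : chains) : homog i j c -> hdeg_part i' c =
  if i == i' then c else 0.
Proof.
move=> /forallP hc; apply/ffunP => b; rewrite ffunE.
transitivity (if i == i' then c b else 0); last by case: ifP; rewrite ?ffunE.
have [->|cb] := eqVneq (c b) 0; first by rewrite !if_same.
by have := hc b; rewrite cb => /andP[/eqP -> _].
Qed.

Lemma diff_homogP i (c : chains) : homog i j c -> homog (i + 1) j (diff c).
Proof. by case: (bigraded_complexP htri hM he s_sq) => + _; apply. Qed.

Lemma diff_hdeg_part i (c : chains) : diff (hdeg_part i c) = hdeg_part (i + 1) (diff c).
Proof.
apply/ffunP => b; rewrite !ffunE.
transitivity (\sum_u (if (hdeg b)%:Z == i + 1 then c u * diff_coef s u b else 0)).
  apply: eq_bigr => u _; rewrite ffunE.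
  have [->|nz] := eqVneq (diff_coef s u b) 0; first by rewrite !mulr0 if_same.
  have [-> _] := diff_coef_degree htri hM he nz.
  rewrite -addn1 PoszD (inj_eq (addIr 1)).
  by case: eqP => _; rewrite ?mul0r.
by case: ifP => // _; rewrite big1.
Qed.

Lemma hdeg_part_is_linear i : linear (hdeg_part i).
Proof.
move=> a u v; apply/ffunP => b; rewrite !ffunE; case: ifP => _ //.
by rewrite scaler0 addr0.
Qed.
HB.instance Definition _ i := GRing.isLinear.Build k chains chains _ (hdeg_part i)
  (hdeg_part_is_linear i).

Lemma hdeg_le b : (hdeg (b : generator n e) < (size e).+1)%N.
Proof.
rewrite ltnS /hdeg /weight -[X in (_ <= X)%N]card_ord -sum1_card.
by apply: leq_sum => p _; case: (gen_state b p).
Qed.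

Lemma hdeg_part_sum (c : chains) : \sum_(i < (size e).+1) hdeg_part i c = c.
Proof.
apply/ffunP => b; rewrite sum_ffunE (bigD1 (Ordinal (hdeg_le b))) //= ffunE eqxx.
rewrite big1 ?addr0 // => i ib; rewrite ffunE; case: eqP => // -[bi].
by case/eqP: ib; apply: val_inj.
Qed.

Local Notation N := (size e).+1.

Let basis (i : 'I_N) : 'I_(r i j) -> homology n s e i j := sval (cid (r_rank i j)).
Let basisP (i : 'I_N) := svalP (cid (r_rank i j)).
Let lift (i : 'I_N) (l : 'I_(r i j)) : cycles n s e i j := sval (proj_surj (basis l)).

Let class_lift (i : 'I_N) (l : 'I_(r i j)) : class i (lift l) = basis l.
Proof. by rewrite /lift; case: proj_surj. Qed.

Let lift_homog (i : 'I_N) (l : 'I_(r i j)) : homog i j (cycle_val (lift l)).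
Proof. by case: (lift l) => z /=; rewrite unfold_in => /andP[]. Qed.

Let lift_cycle (i : 'I_N) (l : 'I_(r i j)) : diff (cycle_val (lift l)) = 0.
Proof. by case: (lift l) => z /=; rewrite unfold_in => /andP[_ /eqP]. Qed.

Local Notation lifts := {i : 'I_N & 'I_(r i j)}.
Local Notation cells := {b : generator n e | qdeg b == j}.
Local Notation I := (cells + lifts)%type.
Local Notation V := {ffun I -> k^o}.
Local Notation tg l := (inr (Tagged (fun i : 'I_N => 'I_(r i j)) l)).

(* The mapping cone of [lift], in the part of quantum degree [j]; the degrees are
   shifted so that the copy of the homology keeps its degree. *)
Let deg (l : I) : nat := match l with inl u => (hdeg (val u)).+1 | inr y => tag y end.

Definition cone_chain (v : V) : chains :=
  [ffun b => if insub b is Some u then v (inl u) else 0].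

Definition cone_cycle (v : V) : chains :=
  \sum_(y : lifts) v (inr y) *: cycle_val (lift (tagged y)).

Definition chain_cone (c : chains) : V :=
  [ffun l : I => match l return k^o with inl u => c (val u) | inr _ => 0 end].

(** The usual sign of a mapping cone is absent: the copy of the homology carries the zero
    differential and its generators are sent to cycles. *)
Definition cone_diff (v : V) : V := chain_cone (diff (cone_chain v) + cone_cycle v).

Lemma cone_chain_pure v : pure (cone_chain v).
Proof. by move=> b; rewrite ffunE; case: insubP => [u /eqP //|_]; rewrite eqxx. Qed.

Lemma pureD (c d : chains) : pure c -> pure d -> pure (c + d).
Proof.
move=> pc pd b; rewrite ffunE; have [->|cb _] := eqVneq (c b) 0; last exact: pc.
by rewrite add0r; apply: pd.
Qed.

Lemma pureZ a (c : chains) : pure c -> pure (a *: c).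
Proof.
move=> pc b; rewrite ffunE; have [->|cb _] := eqVneq (c b) 0; last exact: pc.
by rewrite scaler0 eqxx.
Qed.

Lemma pure_sum (T : finType) (c : T -> chains) : (forall t, pure (c t)) -> pure (\sum_t c t).
Proof.
move=> pc; apply: (big_ind pure) => //; last exact: pureD.
by move=> b; rewrite ffunE eqxx.
Qed.

Lemma pure_diff (c : chains) : pure c -> pure (diff c).
Proof.
move=> pc; rewrite -[c]hdeg_part_sum linear_sum; apply: pure_sum => i.
exact/homog_pure/diff_homogP/hdeg_part_homog.
Qed.

Lemma cone_cycle_pure v : pure (cone_cycle v).
Proof. by apply: pure_sum => y; apply/pureZ/homog_pure/lift_homog. Qed.

Lemma chain_coneK (c : chains) : pure c -> cone_chain (chain_cone c) = c.
Proof.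
move=> pc; apply/ffunP => b; rewrite ffunE; case: insubP => [u _ ub|nb].
  by rewrite ffunE -ub.
by apply/eqP; apply: contraNT nb; rewrite eq_sym => cb; rewrite (pc b cb).
Qed.

Lemma cone_diff_is_linear : linear cone_diff.
Proof.
move=> a u v.
have cE : cone_chain (a *: u + v) = a *: cone_chain u + cone_chain v.
  by apply/ffunP => b; rewrite !ffunE; case: insub => [w|]; rewrite ?ffunE // scaler0 addr0.
have yE : cone_cycle (a *: u + v) = a *: cone_cycle u + cone_cycle v.
  rewrite /cone_cycle scaler_sumr -big_split; apply: eq_bigr => y _ /=.
  by rewrite !ffunE scalerDl scalerA.
rewrite /cone_diff cE yE linearP addrACA -scalerDr; apply/ffunP => l; rewrite !ffunE.
by case: l => [w|y]; rewrite ?ffunE // scaler0 addr0.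
Qed.
HB.instance Definition _ := GRing.isLinear.Build k V V _ cone_diff cone_diff_is_linear.

Lemma cone_diff_deg l m : cone_diff (ffun_basis k l) m != 0 -> deg m = (deg l).+1.
Proof.
rewrite ffunE; case: m => [m|y]; last by rewrite eqxx.
rewrite ffunE /=; have [->|nz] := eqVneq (diff (cone_chain (ffun_basis k l)) (val m)) 0.
  rewrite add0r sum_ffunE => nz.
  case: (pickP (fun y : lifts => (ffun_basis k l) (inr y) * cycle_val (lift (tagged y)) (val
    m) != 0)).
    move=> y nzy; have : ffun_basis k l (inr y) != 0 by apply: contraNneq nzy => ->;
      rewrite mul0r.
    rewrite ffunE => /natr_neq0/eqP <- /=; congr _.+1.
    have zy : cycle_val (lift (tagged y)) (val m) != 0 by apply: contraNneq nzy => ->;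
      rewrite mulr0.
    have /forallP/(_ (val m)) := lift_homog (tagged y).
    by rewrite zy => /andP[/eqP[]].
  move=> no; case/eqP: nz; rewrite big1 // => y _; rewrite ffunE.
  by move/negbFE/eqP: (no y).
move=> _; move: nz; rewrite ffunE => nz.
case: (pickP (fun u => cone_chain (ffun_basis k l) u * diff_coef s u (val m) != 0)) => [u
  nzu|no]; last first.
  by case/eqP: nz; rewrite big1 // => u _; move/negbFE/eqP: (no u).
have du : diff_coef s u (val m) != 0 by apply: contraNneq nzu => ->; rewrite mulr0.
have : cone_chain (ffun_basis k l) u != 0 by apply: contraNneq nzu => ->; rewrite mul0r.
rewrite ffunE; case: insubP => [w _ wu|]; last by rewrite eqxx.
rewrite ffunE => /natr_neq0/eqP <- /=.
by rewrite wu (diff_coef_degree htri hM he du).1.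
Qed.

Lemma cone_diff_sq v : cone_diff (cone_diff v) = 0.
Proof.
set c := diff (cone_chain v) + cone_cycle v.
have pc : pure c by apply: pureD; [apply/pure_diff/cone_chain_pure|apply: cone_cycle_pure].
have dc : diff c = 0.
  rewrite /c linearD /= (diff_sq htri hM he s_sq) add0r linear_sum big1 // => y _.
  by rewrite linearZ /= lift_cycle scaler0.
have yc : cone_cycle (chain_cone c) = 0.
  by rewrite /cone_cycle big1 // => y _; rewrite ffunE scale0r.
rewrite /cone_diff -/c chain_coneK // dc yc addr0.
by apply/ffunP => -[u|y]; rewrite !ffunE.
Qed.

Lemma cone_cycle_part (i : 'I_N) v :
  hdeg_part i (cone_cycle v) = cycle_val (\sum_l (v (tg l) : k) *: lift (i := i) l).
Proof.
rewrite cycle_val_sum linear_sum /=.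
transitivity (\sum_(i' < N) \sum_(l : 'I_(r i' j))
    hdeg_part i (v (tg l) *: cycle_val (lift l))).
  rewrite (sig_big_dep xpredT (fun _ => xpredT) (fun (i' : 'I_N) (l : 'I_(r i' j)) =>
    hdeg_part i (v (tg l) *: cycle_val (lift l)))).
  by apply: eq_bigr => -[].
rewrite (bigD1 i) //= [X in _ + X]big1 ?addr0 => [|i' i'i].
  by apply: eq_bigr => l _; rewrite linearZ /= (hdeg_part_id _ (lift_homog l)) eqxx.
rewrite big1 // => l _; rewrite linearZ /= (hdeg_part_id _ (lift_homog l)).
by case: eqP => [[ii]|_]; [case/eqP: i'i; apply: val_inj | rewrite scaler0].
Qed.

(** The two halves of [has_rank] in turn: independence kills the homology part of a cone cycle, and
    spanning up to a regular multiplier bounds what is left. *)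
Lemma cone_acyclic v : cone_diff v = 0 ->
  exists (t : k) (w : V), GRing.lreg t /\ t *: v = cone_diff w.
Proof.
set c := cone_chain v => Dv.
have pc : pure c by apply: cone_chain_pure.
have c0 : diff c + cone_cycle v = 0.
  rewrite -[LHS]chain_coneK; last by apply: pureD; [apply: pure_diff|apply: cone_cycle_pure].
  rewrite -/(cone_diff v) Dv; apply/ffunP => b; rewrite !ffunE.
  by case: insub => // u; rewrite ffunE.
(* The combination of lifts is the boundary of [- c], so in each degree its class is zero and its
   coefficients vanish. *)
have vy (y : lifts) : v (inr y) = 0.
  case: y => i l; apply: ((basisP i).1 (fun l => v (tg l))).
  rewrite -/(basis (i := i)).
  under eq_bigr do rewrite -class_lift.
  rewrite class_sum; apply/class_eq0; exists (hdeg_part (i%:Z - 1) (- c)).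
    by apply: hdeg_part_homog; rewrite -scaleN1r; apply: pureZ.
  rewrite diff_hdeg_part subrK linearN -cone_cycle_part.
  by congr hdeg_part; apply/eqP; rewrite eq_sym -addr_eq0 addrC c0.
have yv : cone_cycle v = 0 by rewrite /cone_cycle big1 // => y _; rewrite vy scale0r.
have dc : diff c = 0 by move: c0; rewrite yv addr0.
have vc : chain_cone c = v.
  apply/ffunP => -[u|y]; rewrite ffunE ?vy // ffunE.
  by rewrite valK.
(* In each degree, a regular multiple of the part of [c] is a combination of lifts plus a boundary;
   the multipliers are then brought to the common value [t]. *)
have /fin_all_exists[u uP] (i : 'I_N) : exists u : (k * chains) * ('I_(r i j) -> k),
    [/\ GRing.lreg u.1.1, homog (i%:Z - 1) j u.1.2 &
      diff u.1.2 + \sum_l u.2 l *: cycle_val (lift l) = u.1.1 *: hdeg_part i c].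
  have ci : hdeg_part i c \in is_cycle s i j.
    by rewrite unfold_in hdeg_part_homog // diff_hdeg_part dc linear0 eqxx.
  have [t treg [a ta]] := (basisP i).2 (class i (Cycle ci)).
  have : class i (t *: Cycle ci - \sum_l a l *: lift l) = 0.
    have scaleE z : t *: class i z = class i (t *: z) := mquot_scale_proj _ t z.
    have subE z z' : class i z = class i z' -> class i (z - z') = 0.
      move/eqP; rewrite proj_eq => H; apply/eqP; rewrite -(class0 n s e i j) proj_eq subr0.
      exact: H.
    apply: subE; rewrite -scaleE ta -class_sum.
    by apply: eq_bigr => l _; rewrite class_lift.
  move/class_eq0 => [b hb db]; exists ((t, b), a); split=> //=.
  by rewrite db -cycle_val_sum /= subrK.
pose t := \prod_i (u i).1.1; pose t' i := \prod_(i' | i' != i) (u i').1.1.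
have tE i : t = t' i * (u i).1.1 by rewrite /t (bigD1 i) //= mulrC.
have treg : GRing.lreg t.
  rewrite /t; elim/big_ind: _ => [|a b|i _]; [exact: lreg1|exact: lregM|].
  by case: (uP i).
pose b := \sum_i t' i *: (u i).1.2.
have pb : pure b by apply: pure_sum => i; apply: pureZ; case: (uP i) => _ /homog_pure.
pose w : V := [ffun l : I => match l return k^o with
  | inl x => b (val x) | inr y => t' (tag y) * (u (tag y)).2 (tagged y) end].
exists t, w; split=> //; rewrite /cone_diff -{1}vc.
have -> : cone_chain w = b.
  rewrite -[RHS]chain_coneK //; apply/ffunP => x; rewrite !ffunE.
  by case: insub => // z; rewrite !ffunE.
have -> : cone_cycle w = \sum_i t' i *: \sum_l (u i).2 l *: cycle_val (lift l).
  transitivity (\sum_(i < N) \sum_(l : 'I_(r i j))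
      w (tg l) *: cycle_val (lift l)).
    rewrite (sig_big_dep xpredT (fun _ => xpredT) (fun (i : 'I_N) (l : 'I_(r i j)) =>
      w (tg l) *: cycle_val (lift l))).
    by apply: eq_bigr => -[].
  apply: eq_bigr => i _; rewrite scaler_sumr; apply: eq_bigr => l _.
  by rewrite ffunE scalerA.
have -> : diff b + \sum_i t' i *: \sum_l (u i).2 l *: cycle_val (lift l) = t *: c.
  rewrite /b linear_sum -big_split -[in RHS](hdeg_part_sum c) scaler_sumr.
  apply: eq_bigr => i _ /=; rewrite linearZ /= -scalerDr.
  by case: (uP i) => _ _ ->; rewrite scalerA -tE.
by apply/ffunP => -[x|y]; rewrite !ffunE // scaler0.
Qed.

(** The equality of odd and even ranks in the cone, where the shift by one makes chain generators of
    even [hdeg] count as odd. *)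
Lemma euler_qdeg :
  (#|[pred b : generator n e | (qdeg b == j) && ~~ odd (hdeg b)]| + \sum_(i < N | odd i) r i
    j =
   #|[pred b : generator n e | (qdeg b == j) && odd (hdeg b)]| + \sum_(i < N | ~~ odd i) r i
     j)%N.
Proof.
have card_cone (P : pred I) :
    #|P| = (#|[pred b : generator n e | (qdeg b == j) && oapp (fun u => P (inl u)) false
      (insub b)]| +
      \sum_(i < N) #|[pred l : 'I_(r i j) | P (tg l)]|)%N.
  rewrite -!sum1_card big_sumType /=; congr (_ + _)%N.
    rewrite (reindex_omap (val : cells -> generator n e) insub) /=; last first.
      by move=> b /andP[bj _]; case: insubP => [u _ /= ->//|]; rewrite bj.
    apply: eq_bigl => u; rewrite [val u \in _]inE /=.
    have -> : insub (sval u) = Some u := valK u.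
    by rewrite (valP u : qdeg (sval u) == j) /= eqxx andbT.
  transitivity (\sum_(i < N) \sum_(l : 'I_(r i j) | P (tg l)) 1)%N.
    rewrite (sig_big_dep xpredT (fun (i : 'I_N) (l : 'I_(r i j)) => P (tg l)) (fun _ _ =>
      1%N)).
    by apply: eq_bigl => -[].
  by apply: eq_bigr => i _; rewrite sum1_card.
have := acyclic_card cone_diff_deg cone_diff_sq cone_acyclic.
rewrite !card_cone => H.
have part (c : bool) (P : pred I) : (forall l, P l = (odd (deg l) == c)) ->
    (#|[pred b : generator n e | (qdeg b == j) && oapp (fun u => P (inl u)) false (insub b)]| +
      \sum_(i < N) #|[pred l : 'I_(r i j) | P (tg l)]| =
    #|[pred b : generator n e | (qdeg b == j) && (odd (hdeg b) == ~~ c)]| +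
      \sum_(i < N | odd i == c) r i j)%N.
  move=> PE; congr (_ + _)%N.
    apply: eq_card => b; rewrite !inE; case bj: (qdeg b == j) => //=.
    case: insubP => [u _ ub|]; last by rewrite bj.
    by rewrite /= PE /= -ub; case: odd; case: (c).
  rewrite [RHS]big_mkcond; apply: eq_bigr => i _ /=.
  case ic: (odd i == c).
    by rewrite -[RHS]card_ord; apply: eq_card => l; rewrite !inE PE /= ic.
  by apply: eq_card0 => l; rewrite !inE PE /= ic.
move: H; rewrite (part true) => [|l]; last by rewrite inE eqb_id.
rewrite (part false) => [|l]; last by rewrite inE eqbF_neg.
have c1 : #|[pred b : generator n e | (qdeg b == j) && (odd (hdeg b) == ~~ true)]| =
    #|[pred b : generator n e | (qdeg b == j) && ~~ odd (hdeg b)]|.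
  by apply: eq_card => b; rewrite !inE eqbF_neg.
have c2 : #|[pred b : generator n e | (qdeg b == j) && (odd (hdeg b) == ~~ false)]| =
    #|[pred b : generator n e | (qdeg b == j) && odd (hdeg b)]|.
  by apply: eq_card => b; rewrite !inE eqb_id.
rewrite c1 c2 (eq_bigl (fun i : 'I_N => odd i)); last by move=> i; rewrite eqb_id.
by rewrite [X in _ = (_ + X)%N](eq_bigl (fun i : 'I_N => ~~ odd i)) // => i; rewrite eqbF_neg.
Qed.

End EulerCharacteristic.

(** * From counts in each quantum degree to Laurent polynomials *)

Lemma qvar_neq0 : qvar != 0.
Proof. by rewrite /qvar tofrac_eq0 polyX_eq0. Qed.

Lemma qvar_expz_sum (I : finType) (F : I -> int) : \prod_i qvar ^ F i = qvar ^ (\sum_i F i).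
Proof.
apply: (big_ind2 (fun x y => x = qvar ^ y)) => //.
by move=> _ x _ y -> ->; rewrite expfzDr // qvar_neq0.
Qed.

Lemma color_polynomial_gens (n : nat) (G : ribbon_graph) (e : seq {set dart G}) :
  color_polynomial n e = \sum_(b : generator n e) (-1) ^+ hdeg b * qvar ^ qdeg b.
Proof.
transitivity (\sum_(a : state e) \sum_(f : {ffun circle a -> 'I_n})
    (-1) ^+ weight a * (qvar ^ (\sum_c ((n./2)%:Z - (f c : nat)%:Z) + (n./2 * weight
      a)%N%:Z))); last first.
  rewrite (sig_big_dep xpredT (fun _ => xpredT) (fun (a : state e) (f : {ffun circle a ->
    'I_n}) =>
    (-1) ^+ weight a * (qvar ^ (\sum_c ((n./2)%:Z - (f c : nat)%:Z) + (n./2 * weight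
      a)%N%:Z)))).
  by apply: eq_bigr => -[a f].
apply: eq_bigr => a _.
transitivity ((- qvar ^+ n./2) ^+ weight a *
    \sum_(f : {ffun circle a -> 'I_n}) \prod_c qvar ^ ((n./2)%:Z - (f c : nat)%:Z)).
  congr (_ * _); rewrite -(bigA_distr_bigA (fun (c : circle a) (l : 'I_n) => qvar ^
    ((n./2)%:Z - (l : nat)%:Z))).
  by rewrite prodr_const /= card_sig.
rewrite mulr_sumr; apply: eq_bigr => f _.
rewrite qvar_expz_sum [in LHS]exprNn -exprM -mulrA; congr (_ * _).
by rewrite exprnP -expfzDr ?qvar_neq0 // addrC.
Qed.

Lemma fsum_seq (V : nmodType) (T : choiceType) (s : seq T) (f : T -> V) : uniq s ->
  (forall i, i \notin s -> f i = 0) ->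
  \sum_(i \in @classical_sets.setT T) f i = \sum_(i <- s) f i.
Proof. by move=> us fs; rewrite (fsbigE s) //; [apply: eq_bigl => i;
  apply/asboolP | move=> i _; exact: fs]. Qed.

Section Laurent.
Variables (G : ribbon_graph) (M : {set {set dart G}}) (e : seq {set dart G}).
Hypotheses (htri : trivalent G) (hM : perfect_matching M) (he : enumerates e M).
Variables (k : comNzRingType) (n : nat) (s : k).
Hypothesis s_sq : s ^+ 2 = n%:R.
Variable r : int -> int -> nat.
Hypothesis r_rank : forall i j : int, has_rank (homology n s e i j) (r i j).

Lemma graded_euler_color : color_polynomial n e = graded_euler r.
Proof.
pose J := undup [seq qdeg b | b : generator n e].
pose N := (size e).+1.
have r0 i j : j \notin J -> r i j = 0%N.
  move=> jJ; apply: (rank_support (r_rank i j)) => b; apply/negbTE; rewrite negb_and.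
  by apply/orP; right; apply: contra jJ => /eqP <-; rewrite mem_undup image_f.
have r0' (i : int) j : i \notin [seq l%:Z | l <- iota 0 N] -> r i j = 0%N.
  move=> iN; apply: (rank_support (r_rank i j)) => b; apply/negbTE; rewrite negb_and.
  apply/orP; left; apply: contra iN => /eqP <-.
  by apply: map_f; rewrite mem_iota add0n hdeg_le.
(* The quantum degree is moved to the outer sum because the count of [euler_qdeg] is made for one
   [j] at a time. *)
have -> : graded_euler r = \sum_(j <- J) qvar ^ j * \sum_(i < N) (-1) ^+ i * (r i j)%:R.
  rewrite /graded_euler (fsum_seq (s := [seq l%:Z | l <- iota 0 N])); first last.
  - move=> i iN; rewrite (fsum_seq (s := [::])) ?big_nil ?mulr0 // => j _.
    by rewrite r0' // mulr0.
  - by rewrite map_inj_uniq ?iota_uniq // => x y [].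
  rewrite big_map -/(index_iota 0 N) big_mkord.
  transitivity (\sum_(i < N) \sum_(j <- J) (-1) ^+ i * (qvar ^ j * (r i j)%:R)).
    apply: eq_bigr => i _; rewrite (fsum_seq (s := J)) ?undup_uniq //.
      by rewrite mulr_sumr; apply: eq_bigr.
    by move=> j jJ; rewrite r0 // mulr0.
  rewrite exchange_big; apply: eq_bigr => j _; rewrite mulr_sumr.
  by apply: eq_bigr => i _; rewrite mulrCA.
rewrite color_polynomial_gens.
transitivity (\sum_(b : generator n e) \sum_(j <- J | qdeg b == j) qvar ^ j * (-1) ^+ hdeg b).
  apply: eq_bigr => b _; rewrite (big_rem (qdeg b)) /= ?eqxx;
    last by rewrite mem_undup image_f.
  rewrite mulrC big1_seq ?addr0 // => j /andP[/eqP <-].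
  by rewrite mem_rem_uniq ?undup_uniq // inE eqxx.
rewrite (exchange_big_dep xpredT) //=; apply: eq_bigr => j _.
rewrite -mulr_sumr; congr (_ * _).
have sgn (A : pred (generator n e)) : \sum_(b | A b) (-1) ^+ hdeg b =
    #|[pred b | A b && ~~ odd (hdeg b)]|%:R - #|[pred b | A b && odd (hdeg b)]|%:R :>
      {fraction {poly int}}.
  rewrite (bigID (fun b => odd (hdeg b))) /= addrC -!sum1_card !natr_sum -sumrN; congr (_ + _).
    by apply: eq_bigr => b /andP[_ /negPf ob]; rewrite -signr_odd ob.
  by apply: eq_bigr => b /andP[_ ob]; rewrite -signr_odd ob.
rewrite sgn (bigID (fun i : 'I_N => odd i)) /= addrC.
have Ro : \sum_(i < N | odd i) (-1) ^+ i * (r i j)%:R =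
    - (\sum_(i < N | odd i) r i j)%N%:R :> {fraction {poly int}}.
  by rewrite natr_sum -sumrN; apply: eq_bigr => i oi; rewrite -signr_odd oi mulN1r.
have Re : \sum_(i < N | ~~ odd i) (-1) ^+ i * (r i j)%:R =
    (\sum_(i < N | ~~ odd i) r i j)%N%:R :> {fraction {poly int}}.
  by rewrite natr_sum; apply: eq_bigr => i /negPf oi; rewrite -signr_odd oi mul1r.
rewrite Ro Re.
have := congr1 (fun x => x%:R : {fraction {poly int}}) (euler_qdeg htri hM he s_sq r_rank j).
by rewrite !natrD => /(canRL (addrK _)) ->; ring.
Qed.

End Laurent.

Theorem theoremB (k : comNzRingType) (n : nat) (sqrtn : k)
    (hsqrtn : sqrtn ^+ 2 = n%:R)
    (G : ribbon_graph) (M : {set {set dart G}})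
    (hconn : connected_graph G) (htri : trivalent G)
    (hM : perfect_matching M)
    (e : seq {set dart G}) (he : enumerates e M) :
  [/\ bigraded_complex n sqrtn e,
      (forall (G' : ribbon_graph) (M' : {set {set dart G'}})
              (e' : seq {set dart G'}),
         equivalent M M' -> enumerates e' M' ->
         forall i j : int,
           isomorphic (homology n sqrtn e i j) (homology n sqrtn e' i j)),
      (forall r : int -> int -> nat,
         (forall i j : int, has_rank (homology n sqrtn e i j) (r i j)) ->
         color_polynomial n e = graded_euler r) &
      (integral_domain k ->
         exists r : int -> int -> nat,
           forall i j : int, has_rank (homology n sqrtn e i j) (r i j))].
Proof.
split.
- exact: (bigraded_complexP htri hM he hsqrtn).
- by move=> G' M' e' MM' he' i j; exact: (equivalent_homology _ _ _ _ he MM' he').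
- by move=> r; exact: (graded_euler_color htri hM he hsqrtn).
- exact: homology_has_rank.
Qed.
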